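(* Let $d=2$, let the coefficient be constant, $\alpha(\mathbf x)\equiv\alpha_0>0$, and let $k\ge1$. Let $u_h\in U_h$ be the finite element solution, i.e. $a(u_h,v_h)=(f,v_h)$ for all $v_h\in U_h$. Let $\hat b^{(k+2)}$ be an orthogonal bubble of degree $k+2$ on the reference triangle and, for each $\tau\in\mathcal T_h$, let $b^{(k+2)}_\tau$ be the corresponding orthogonal bubble on $\tau$, assumed to have non-zero total flux $\int_{\partial\tau}\partial b_\tau^{(k+2)}/\partial\mathbf n\,ds\neq0$. Define $$\tilde u_h=u_h+\sum_{\tau\in\mathcal T_h}\gamma_\tau b^{(k+2)}_\tau,\qquad \gamma_\tau=\left(\int_{\partial\tau}\alpha\frac{\partial b^{(k+2)}_\tau}{\partial\mathbf n}\,ds\right)^{-1}\left(-\int_\tau f\,d\mathbf x-\int_{\partial\tau}\alpha\frac{\partial u_h}{\partial\mathbf n}\,ds\right).$$ Then for every $\tau\in\mathcal T_h$ and $v_h\in U_h$ one has $\int_\tau\nabla b^{(k+2)}_\tau\cdot\nabla v_h\,d\mathbf x=0$, and the post-processed solution still satisfies the original finite element equations: $$a(\tilde u_h,v_h)=(f,v_h)\qquad\text{for all }v_h\in U_h.$$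
   Context: $\Omega\subset\mathbb R^2$ is a bounded polygonal domain, $f\in L^2(\Omega)$, and $\mathcal T_h$ is a quasi-uniform and shape-regular triangulation of $\Omega$ into triangles $\tau$ with $\operatorname{diam}(\tau)\le h<1$. The finite element space is $$U_h=\{v\in C(\overline\Omega): v|_\tau\in\mathcal P_k\ \text{for all }\tau\in\mathcal T_h,\ v|_{\partial\Omega}=0\},$$ where $\mathcal P_k$ is the space of polynomials of total degree at most $k$. The forms are $a(v,w)=\int_\Omega\alpha\nabla v\cdot\nabla w\,d\mathbf x$ and $(v,w)=\int_\Omega vw\,d\mathbf x$. Reference triangle: $\hat\tau=\{(x,y): x\ge0,\ y\ge0,\ 1-x-y\ge0\}$. For an integer $m\ge3$, an orthogonal bubble of degree $m$ on $\hat\tau$ is a polynomial $\hat b^{(m)}\in\mathcal P_m(\hat\tau)$ such that $$\hat b^{(m)}=0\ \text{on }\partial\hat\tau,\qquad \int_{\hat\tau}\hat b^{(m)}\,\Delta p\,d\mathbf x=0\ \ \forall p\in\mathcal P_{m-2}(\hat\tau),\qquad \int_{\hat\tau}\Delta\hat b^{(m)}\,d\mathbf x\ne0.$$ For $\tau\in\mathcal T_h$ let $F_\tau:\hat\tau\to\tau$ be an affine bijection; the orthogonal bubble on $\tau$ is $b^{(m)}_\tau=\hat b^{(m)}\circ F_\tau^{-1}$ on $\tau$, extended by zero to the rest of $\Omega$. On $\partial\tau$, $\mathbf n$ is the outward unit normal to $\tau$, and normal derivatives of piecewise polynomials are taken from inside $\tau$. *)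

(* Defs.v *)
From HB Require Import structures.
From mathcomp Require Import all_boot all_order all_algebra.
From mathcomp Require Import all_classical all_reals all_analysis.
Set Implicit Arguments.
Unset Strict Implicit.
Unset Printing Implicit Defensive.
Import Order.TTheory GRing.Theory Num.Theory.
Import numFieldNormedType.Exports.
Local Open Scope classical_set_scope.
Local Open Scope ring_scope.

(* The plane is R * R.  Its library norm is the sup norm; it is used only for
   topology and boundedness, and every length below is the Euclidean [enorm]. *)

Definition lebesgue2 (R : realType) :
    {measure set (measurableTypeR R * measurableTypeR R) -> \bar R} :=
  (@lebesgue_measure R \x @lebesgue_measure R)%E.

Section Plane.
Variable R : realType.
Implicit Types (a b z w : R * R) (v p : R * R -> R) (A : set (R * R)).

Definition dot z w : R := z.1 * w.1 + z.2 * w.2.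
Definition enorm z : R := Num.sqrt (dot z z).

Definition bdry A : set (R * R) := closure A `\` interior A.

Definition segment a b : set (R * R) :=
  [set z | exists2 t : R, 0 <= t <= 1 & z = a + t *: (b - a)].

Definition diam A : R :=
  sup [set r | exists z w, [/\ A z, A w & r = enorm (z - w)]].

Definition inradius A : R :=
  sup [set r | 0 <= r /\ exists z, [set w | enorm (w - z) <= r] `<=` A].

(* Pointwise partial derivatives.  For a continuous piecewise polynomial they
   exist off the mesh skeleton, a null set; there 'D takes an irrelevant
   default value. *)
Definition grad v z : R * R := ('D_((1, 0) : R * R) v z, 'D_((0, 1) : R * R) v z).

Definition laplacian v z : R :=
  'D_((1, 0) : R * R) ('D_((1, 0) : R * R) v) z +
  'D_((0, 1) : R * R) ('D_((0, 1) : R * R) v) z.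

(* polynomial functions of total degree at most k *)
Definition polyfun (k : nat) p : Prop :=
  exists c : nat -> nat -> R, forall z,
    p z = \sum_(i < k.+1) \sum_(j < k.+1 | (i + j <= k)%N)
            c i j * z.1 ^+ i * z.2 ^+ j.

(* slits are allowed; the segments may overlap *)
Definition polygonal_domain A : Prop :=
  [/\ open A, connected A, A !=set0, bounded_set A &
      exists2 s : seq ((R * R) * (R * R)),
        (forall e, e \in s -> e.1 != e.2) &
        bdry A = \bigcup_(e in [set` s]) segment e.1 e.2].

Definition affine_map (F : R * R -> R * R) : Prop :=
  exists c u w, forall z, F z = c + z.1 *: u + z.2 *: w.

End Plane.

(* A triangle is given by its three vertices, indexed cyclically by 'I_3. *)
Definition triangle (R : realType) := 'I_3 -> R * R.

Section Triangle.
Variable R : realType.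
Implicit Types (t : triangle R) (i : 'I_3) (v : R * R -> R) (z : R * R).

Definition hull t : set (R * R) :=
  [set z | exists l : 'I_3 -> R,
     [/\ forall i, 0 <= l i, \sum_i l i = 1 & z = \sum_i l i *: t i]].

Definition nondegenerate t : Prop :=
  (t 1 - t 0).1 * (t (1 + 1) - t 0).2 - (t 1 - t 0).2 * (t (1 + 1) - t 0).1 != 0.

(* edge number i is the one opposite to vertex i *)
Definition edge t i : set (R * R) := segment (t (i + 1)) (t (i + 1 + 1)).

Definition outer_normal t i : R * R :=
  let e := t (i + 1 + 1) - t (i + 1) in
  let q := (e.2, - e.1) in
  (- (Num.sg (dot q (t i - t (i + 1))) / enorm q)) *: q.

(* \int_(boundary of t) g ds; the integrand may depend on the edge, as normal
   derivatives do *)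
Definition boundary_integral t (g : 'I_3 -> R * R -> R) : R :=
  \sum_i enorm (t (i + 1 + 1) - t (i + 1)) *
    \int[lebesgue_measure]_(s in `[0, 1])
      g i (t (i + 1) + s *: (t (i + 1 + 1) - t (i + 1))).

(* outward normal derivative at z on edge i: trace of 'D_n v from the interior
   of the triangle *)
Definition normal_derivative t i v z : R :=
  lim ('D_(outer_normal t i) v @ within (interior (hull t)) (nbhs z)).

End Triangle.

Section Mesh.
Variables (R : realType) (n : nat).
Implicit Types (T : 'I_n -> triangle R) (Omega : set (R * R)).

Record triangulation Omega (h : R) T : Prop := {
  mesh_nondegenerate : forall i, nondegenerate (T i);
  mesh_cover : closure Omega = \bigcup_i hull (T i);
  mesh_inside : forall i, interior (hull (T i)) `<=` Omega;
  mesh_conforming : forall i j, i != j ->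
    [\/ hull (T i) `&` hull (T j) = set0,
        exists p q, T i p = T j q /\ hull (T i) `&` hull (T j) = [set T i p] |
        exists p q, edge (T i) p = edge (T j) q /\
                    hull (T i) `&` hull (T j) = edge (T i) p];
  mesh_size : forall i, diam (hull (T i)) <= h }.

Definition shape_regular (sigma : R) T : Prop :=
  forall i, sigma * diam (hull (T i)) <= inradius (hull (T i)).

Definition quasi_uniform (c h : R) T : Prop :=
  forall i, c * h <= diam (hull (T i)).

(* Functions are total on R * R; values outside the closure of Omega are
   irrelevant. *)
Definition fe_space Omega T (k : nat) : set (R * R -> R) :=
  [set v | [/\ {within closure Omega, continuous v},
      forall i, exists2 p, polyfun k p & forall z, hull (T i) z -> v z = p z &
      forall z, bdry Omega z -> v z = 0]].

End Mesh.

Section Forms.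
Variable R : realType.
Implicit Types (Omega : set (R * R)) (alpha f v w : R * R -> R).

Definition a_form Omega alpha v w : R :=
  \int[lebesgue2 R]_(z in Omega) (alpha z * dot (grad v z) (grad w z)).

Definition l2_form Omega v w : R :=
  \int[lebesgue2 R]_(z in Omega) (v z * w z).

End Forms.

Section Bubble.
Variable R : realType.
Implicit Types (t : triangle R) (F : R * R -> R * R)
  (bhat b alpha f uh : R * R -> R).

Definition ref_triangle : set (R * R) :=
  [set z | [/\ 0 <= z.1, 0 <= z.2 & 0 <= 1 - z.1 - z.2]].

Definition orthogonal_bubble (m : nat) bhat : Prop :=
  [/\ (3 <= m)%N, polyfun m bhat,
      forall z, bdry ref_triangle z -> bhat z = 0,
      forall p, polyfun (m - 2) p ->
        \int[lebesgue2 R]_(z in ref_triangle) (bhat z * laplacian p z) = 0 &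
      \int[lebesgue2 R]_(z in ref_triangle) laplacian bhat z != 0].

(* bhat \o F^-1 on t, extended by zero; 'pinv_ is the inverse of F restricted
   to the reference triangle *)
Definition cell_bubble bhat F t : R * R -> R :=
  (bhat \o 'pinv_(fun=> 0) ref_triangle F) \_ (hull t).

Definition postproc_coef alpha f uh t b : R :=
  (boundary_integral t (fun i z => alpha z * normal_derivative t i b z))^-1 *
  (- (\int[lebesgue2 R]_(z in hull t) f z)
   - boundary_integral t (fun i z => alpha z * normal_derivative t i uh z)).

Definition postprocessed n (T : 'I_n -> triangle R) alpha f uh
    (b : 'I_n -> R * R -> R) : R * R -> R :=
  fun z => uh z + \sum_(i < n) postproc_coef alpha f uh (T i) (b i) * b i z.

End Bubble.
Arguments ref_triangle : clear implicits.

(* Main.v *)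
Require Import Defs.
From HB Require Import structures.
From mathcomp Require Import all_boot all_order all_algebra.
From mathcomp Require Import all_classical all_reals all_analysis.
From mathcomp Require Import measurable_realfun ring lra zify.
Set Implicit Arguments.
Unset Strict Implicit.
Unset Printing Implicit Defensive.
Import Order.TTheory GRing.Theory Num.Theory.
Import numFieldNormedType.Exports.
Local Open Scope classical_set_scope.
Local Open Scope ring_scope.

(** On a cell [tau = F (tau_hat)] integrate by parts: since [b_tau] vanishes on
    the boundary, [int_tau grad b . grad v = - int_tau b (Delta v)].
    Transported to the reference triangle, [(Delta v) \o F] is a polynomial of
    degree at most [k - 2], hence the Laplacian of some [q] in [P_k] (the
    Laplacian maps [P_k] onto [P_(k-2)]), and [int bhat (Delta q) = 0] by
    definition of the bubble.  The correction [sum_tau gamma_tau b_tau] is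
    therefore energy-orthogonal to [U_h] whatever the values of the [gamma_tau].

    Green's formula is only needed for polynomials vanishing on the boundary of
    a convex set, where Fubini and the one-dimensional fundamental theorem of
    calculus suffice.  The change of variables is only needed for polynomials,
    and follows from the fact that Green's formula determines the moments of an
    affine triangle up to a common factor; that factor is nonzero on the
    reference triangle because the bubble has non-zero total flux. *)

(** * Polynomial functions of bounded total degree on the plane *)

Section Polyfun.
Variable R : realType.
Implicit Types (p q : R * R -> R) (z v : R * R).

Definition mono (i j : nat) : R * R -> R := fun z => z.1 ^+ i * z.2 ^+ j.

Lemma scale_funE (a : R) p z : (a *: p) z = a * p z. Proof. by []. Qed.

Lemma polyfun0 k : polyfun k (0 : R * R -> R).
Proof.
exists (fun _ _ => 0) => z; rewrite big1// => i _; rewrite big1// => j _.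
by rewrite !mul0r.
Qed.

Lemma polyfunD k p q : polyfun k p -> polyfun k q -> polyfun k (p + q).
Proof.
move=> [c cE] [d dE]; exists (fun i j => c i j + d i j) => z.
rewrite fctE cE dE -big_split; apply: eq_bigr => i _ /=.
by rewrite -big_split; apply: eq_bigr => j _; rewrite !mulrDl.
Qed.

Lemma polyfunZ k (a : R) p : polyfun k p -> polyfun k (a *: p).
Proof.
move=> [c cE]; exists (fun i j => a * c i j) => z.
rewrite fctE cE /= /GRing.scale/= mulr_sumr; apply: eq_bigr => i _ /=.
by rewrite mulr_sumr; apply: eq_bigr => j _; rewrite !mulrA.
Qed.

Lemma polyfun_mono k i j : (i + j <= k)%N -> polyfun k (mono i j).
Proof.
move=> ijk; exists (fun a b => ((a == i) && (b == j))%:R) => z.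
have ik : (i < k.+1)%N by lia.
have jk : (j < k.+1)%N by lia.
rewrite (bigD1 (Ordinal ik))//= (bigD1 (Ordinal jk))//= !eqxx !mul1r.
rewrite big1 ?addr0; last first.
  by move=> l /andP[_ lj]; rewrite [_ == j](negbTE lj) !mul0r.
rewrite big1 ?addr0// => l li; rewrite big1// => m _.
by rewrite [_ == i](negbTE li) !mul0r.
Qed.

(** A polynomial is a finite combination of monomials, so a property closed under sums and scalings
    only has to be checked on monomials. Most facts about [polyfun] below, including those about
    integrals, are obtained this way. *)
Lemma polyfun_ind k (P : (R * R -> R) -> Prop) :
  P 0 -> (forall p q, P p -> P q -> P (p + q)) ->
  (forall (a : R) p, P p -> P (a *: p)) ->
  (forall i j, (i + j <= k)%N -> P (mono i j)) ->
  forall p, polyfun k p -> P p.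
Proof.
move=> P0 PD PZ Pm p [c cE].
have -> : p = \sum_(i < k.+1) \sum_(j < k.+1 | (i + j <= k)%N)
    c i j *: mono i j.
  apply/funext => z; rewrite cE fct_sumE; apply: eq_bigr => i _.
  by rewrite fct_sumE; apply: eq_bigr => j _; rewrite -mulrA.
by apply: big_ind => // i _; apply: big_ind => // j /Pm; exact: PZ.
Qed.

Lemma polyfunW k l p : (k <= l)%N -> polyfun k p -> polyfun l p.
Proof.
move=> kl; apply: polyfun_ind => [|? ?|? ?|i j ijk].
- exact: polyfun0.
- exact: polyfunD.
- exact: polyfunZ.
- by apply: polyfun_mono; lia.
Qed.

Lemma polyfunM k l p q : polyfun k p -> polyfun l q -> polyfun (k + l) (p * q).
Proof.
move=> pk ql; move: p pk; apply: polyfun_ind => [|p p'|a p|i j ijk].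
- by rewrite mul0r; exact: polyfun0.
- by rewrite mulrDl; exact: polyfunD.
- rewrite (_ : a *: p * q = a *: (p * q)); first exact: polyfunZ.
  by apply/funext => z; rewrite !fctE/= /GRing.scale/= mulrA.
- move: q ql; apply: polyfun_ind => [|p p'|a p|a b abl].
  + by rewrite mulr0; exact: polyfun0.
  + by rewrite mulrDr; exact: polyfunD.
  + rewrite (_ : mono i j * (a *: p) = a *: (mono i j * p));
    first exact: polyfunZ.
    by apply/funext => z; rewrite !fctE/= /GRing.scale/= mulrCA.
  + have -> : mono i j * mono a b = mono (i + a) (j + b).
      by apply/funext => z; rewrite fctE/= /mono !exprD mulrACA.
    by apply: polyfun_mono; lia.
Qed.

Lemma polyfunX k n p : polyfun k p -> polyfun (k * n) (p ^+ n).
Proof.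
move=> pk; elim: n => [|n ih].
  by rewrite expr0 (_ : 1 = mono 0 0) ?muln0; [exact: polyfun_mono|
    apply/funext => z; rewrite /mono !expr0 mulr1].
by rewrite exprS mulnS; exact: polyfunM.
Qed.

Lemma polyfun_cst k (a : R) : polyfun k (cst a).
Proof.
rewrite (_ : cst a = a *: mono 0 0); first exact/polyfunZ/polyfun_mono.
by apply/funext => z; rewrite scale_funE /mono !expr0 !mulr1.
Qed.

Lemma polyfun_fst : polyfun 1 (@fst R R).
Proof.
rewrite (_ : fst = mono 1 0); first exact: polyfun_mono.
by apply/funext => z; rewrite /mono expr1 expr0 mulr1.
Qed.

Lemma polyfun_snd : polyfun 1 (@snd R R).
Proof.
rewrite (_ : snd = mono 0 1); first exact: polyfun_mono.
by apply/funext => z; rewrite /mono expr1 expr0 mul1r.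
Qed.

Lemma affine_map_polyfun (F : R * R -> R * R) : affine_map F ->
  polyfun 1 (fst \o F) /\ polyfun 1 (snd \o F).
Proof.
move=> [c [u [w FE]]]; split.
  rewrite (_ : _ \o _ = cst c.1 + u.1 *: fst + w.1 *: snd); last first.
    by apply/funext => z; rewrite /= FE !fctE/= /GRing.scale/= ![_ * u.1]mulrC
      ![_ * w.1]mulrC.
  by do !apply: polyfunD; [exact: polyfun_cst|apply: polyfunZ;
    exact: polyfun_fst|
     apply: polyfunZ; exact: polyfun_snd].
rewrite (_ : _ \o _ = cst c.2 + u.2 *: fst + w.2 *: snd); last first.
  by apply/funext => z; rewrite /= FE !fctE/= /GRing.scale/= ![_ * u.2]mulrC
    ![_ * w.2]mulrC.
by do !apply: polyfunD; [exact: polyfun_cst|apply: polyfunZ; exact: polyfun_fst|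
   apply: polyfunZ; exact: polyfun_snd].
Qed.

Lemma polyfun_comp_affine k p (F : R * R -> R * R) :
  affine_map F -> polyfun k p -> polyfun k (p \o F).
Proof.
move=> /affine_map_polyfun[F1 F2]; move: p; apply: polyfun_ind.
- exact: polyfun0.
- by move=> p q; exact: polyfunD.
- by move=> a p; exact: (@polyfunZ k a (p \o F)).
- move=> i j ijk.
  rewrite (_ : _ \o _ = (fst \o F) ^+ i * (snd \o F) ^+ j).
    apply: (@polyfunW (1 * i + 1 * j)); first lia.
    by apply: polyfunM; exact: polyfunX.
  by apply/funext => z; rewrite /mono/= fctE !exprfctE.
Qed.

Lemma is_derive_fst z v : is_derive z v (@fst R R) v.1.
Proof.
have d : differentiable (@fst R R) z.
  by apply: linear_differentiable; move=> x; exact: cvg_fst.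
apply: DeriveDef; first exact: diff_derivable.
by rewrite deriveE// diff_lin//; move=> x; exact: cvg_fst.
Qed.

Lemma is_derive_snd z v : is_derive z v (@snd R R) v.2.
Proof.
have d : differentiable (@snd R R) z.
  by apply: linear_differentiable; move=> x; exact: cvg_snd.
apply: DeriveDef; first exact: diff_derivable.
by rewrite deriveE// diff_lin//; move=> x; exact: cvg_snd.
Qed.

(** The truncated predecessors are harmless: when an exponent is 0, its coefficient [i%:R] or [j%:R]
    is 0 as well. *)
Lemma is_derive_mono i j z v : is_derive z v (mono i j)
  (i%:R * z.1 ^+ i.-1 * z.2 ^+ j * v.1 + j%:R * z.1 ^+ i * z.2 ^+ j.-1 * v.2).
Proof.
rewrite (_ : mono i j = fst ^+ i * snd ^+ j); last first.
  by apply/funext => x; rewrite mulrfctE !exprfctE.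
have d1 := is_derive_fst z v; have d2 := is_derive_snd z v.
apply: is_derive_eq (is_deriveM (is_deriveX i d1) (is_deriveX j d2)) _.
rewrite !exprfctE /GRing.scale/=.
by ring.
Qed.

End Polyfun.

(** * Derivatives and Laplacians of polynomials *)

Section PolyfunDerive.
Variable R : realType.
Implicit Types (p q : R * R -> R) (z v w : R * R).

Lemma pair_ext z w : z.1 = w.1 -> z.2 = w.2 -> z = w.
Proof. by case: z w => ? ? [? ?] /= -> ->. Qed.

(** The last clause is there because [k.-1] stays 0 at [k = 0], where the degree bound alone does
    not say that derivatives of constants vanish. *)
Lemma polyfun_is_derive k p v : polyfun k p ->
  exists2 q, (forall z, is_derive z v p (q z)) &
    polyfun k.-1 q /\ (k = 0%N -> q = 0).
Proof.
move: p; apply: polyfun_ind.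
- exists 0; last by split=> //; exact: polyfun0.
  by move=> z; exact: (@is_derive_cst _ _ _ (0 : R)).
- move=> p q [p' dp [p'k p'0]] [q' dq [q'k q'0]]; exists (p' + q').
    by move=> z; exact: is_deriveD.
  split; first exact: polyfunD.
  by move=> k0; rewrite p'0// q'0// addr0.
- move=> a p [p' dp [p'k p'0]]; exists (a *: p').
    by move=> z; exact: is_deriveZ.
  split; first exact: polyfunZ.
  by move=> k0; rewrite p'0// scaler0.
- move=> i j ijk.
  exists ((v.1 * i%:R) *: mono i.-1 j + (v.2 * j%:R) *: mono i j.-1).
    move=> z; apply: is_derive_eq (is_derive_mono i j z v) _.
    rewrite !fctE /mono /GRing.scale/=; ring.
  split.
    case: i ijk => [|i] ijk; case: j ijk => [|j] ijk.
    + rewrite !mulr0 !scale0r addr0; exact: polyfun0.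
    + rewrite !mulr0 !scale0r add0r; apply/polyfunZ/polyfun_mono; simpl; lia.
    + rewrite !mulr0 !scale0r addr0; apply/polyfunZ/polyfun_mono; simpl; lia.
    + by apply: polyfunD; apply/polyfunZ/polyfun_mono; simpl; lia.
  move=> k0; have [-> ->] : i = 0%N /\ j = 0%N by lia.
  by rewrite !mulr0 !scale0r addr0.
Qed.

Lemma polyfun_derivable z v k p : polyfun k p -> derivable p z v.
Proof. by move=> /(polyfun_is_derive v)[q dp _]; have [] := dp z. Qed.

Lemma polyfun_derive v k p : polyfun k p -> polyfun k.-1 ('D_v p).
Proof.
move=> /(polyfun_is_derive v)[q dp [qk _]]; rewrite (_ : 'D_v p = q)//.
by apply/funext => z; apply: derive_val.
Qed.

#[local] Arguments polyfun_derivable z v {k p}.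

Lemma polyfun0_derive z v p : polyfun 0 p -> 'D_v p z = 0.
Proof.
move=> /(polyfun_is_derive v)[q dp [_ q0]].
by apply: etrans (derive_val (df := q z)) _; rewrite q0.
Qed.

Lemma polyfun_differentiable k p z : polyfun k p -> differentiable p z.
Proof.
move: p; apply: polyfun_ind => [|p q|a p|i j _].
- exact: (@differentiable_cst _ _ _ (0 : R)).
- exact: differentiableD.
- exact: differentiableZ.
- rewrite (_ : mono i j = fst ^+ i * snd ^+ j); last first.
    by apply/funext => x; rewrite mulrfctE !exprfctE.
  have dX (f : R * R -> R) l : differentiable f z -> differentiable (f ^+ l) z.
    case: l => [|l] df; last exact: differentiableX.
    by rewrite expr0; exact: (@differentiable_cst _ _ _ (1 : R)).
  by apply: differentiableM; apply: dX; apply: linear_differentiable => x;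
    [exact: cvg_fst|exact: cvg_snd].
Qed.

Lemma polyfun_continuous k p : polyfun k p -> continuous p.
Proof. by move=> pk z;
  exact/differentiable_continuous/polyfun_differentiable/pk. Qed.

Lemma derive_polyfunE k p v : polyfun k p ->
  'D_v p = v.1 *: 'D_((1, 0) : R * R) p + v.2 *: 'D_((0, 1) : R * R) p.
Proof.
move=> pk; apply/funext => z; have dp := polyfun_differentiable z pk.
rewrite !fctE !deriveE// -!linearZ -linearD/=; congr ('d p z _).
by apply: pair_ext; rewrite /= /GRing.scale/= ?mulr1 ?mulr0 ?addr0 ?add0r.
Qed.

Lemma laplacian_mono i j z : laplacian (mono i j) z =
  (i * i.-1)%:R * mono i.-2 j z + (j * j.-1)%:R * mono i j.-2 z.
Proof.
have D1 a b x : 'D_((1, 0) : R * R) (mono a b) x = a%:R * mono a.-1 b x.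
  rewrite (@derive_val _ _ _ _ _ _ _ (is_derive_mono a b x (1,0))).
  by rewrite /mono /=; ring.
have D2 a b x : 'D_((0, 1) : R * R) (mono a b) x = b%:R * mono a b.-1 x.
  rewrite (@derive_val _ _ _ _ _ _ _ (is_derive_mono a b x (0,1))).
  by rewrite /mono /=; ring.
rewrite /laplacian.
rewrite (_ : 'D_((1, 0) : R * R) (mono i j) = i%:R *: mono i.-1 j); last first.
  by apply/funext => x; rewrite D1.
rewrite (_ : 'D_((0, 1) : R * R) (mono i j) = j%:R *: mono i j.-1); last first.
  by apply/funext => x; rewrite D2.
rewrite !deriveZ ?D1 ?D2; last 2 first.
- exact/polyfun_derivable/(@polyfun_mono _ _ _ _ (leqnn _)).
- exact/polyfun_derivable/(@polyfun_mono _ _ _ _ (leqnn _)).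
by rewrite /GRing.scale/= !natrM !mulrA.
Qed.

Lemma laplacianD k p q z : polyfun k p -> polyfun k q ->
  laplacian (p + q) z = laplacian p z + laplacian q z.
Proof.
move=> pk qk; rewrite /laplacian.
have dp x v := polyfun_derivable x v pk;
  have dq x v := polyfun_derivable x v qk.
have d2p x v w := polyfun_derivable x w (polyfun_derive v pk).
have d2q x v w := polyfun_derivable x w (polyfun_derive v qk).
have E v : 'D_v (p + q) = 'D_v p + 'D_v q.
  by apply/funext => x; rewrite deriveD.
rewrite (E (1, 0)) (E (0, 1)) addrACA; congr (_ + _).
  exact: (deriveD (d2p z (1, 0) (1, 0)) (d2q z (1, 0) (1, 0))).
exact: (deriveD (d2p z (0, 1) (0, 1)) (d2q z (0, 1) (0, 1))).
Qed.

Lemma laplacianZ k a p z : polyfun k p ->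
  laplacian (a *: p) z = a * laplacian p z.
Proof.
move=> pk; rewrite /laplacian.
have dp x v := polyfun_derivable x v pk.
have d2p x v w := polyfun_derivable x w (polyfun_derive v pk).
have E v : 'D_v (a *: p) = a *: 'D_v p.
  by apply/funext => x; rewrite deriveZ.
rewrite (E (1, 0)) (E (0, 1)) mulrDr; congr (_ + _).
  exact: (deriveZ a (d2p z (1, 0) (1, 0))).
exact: (deriveZ a (d2p z (0, 1) (0, 1))).
Qed.

Lemma laplacian0 z : laplacian (0 : R * R -> R) z = 0.
Proof.
by rewrite -(scale0r (0 : R * R -> R)) (@laplacianZ 0) ?mul0r//;
  exact: polyfun0.
Qed.

Lemma polyfun_laplacian k p : polyfun k p -> polyfun k.-2 (laplacian p).
Proof.
move=> pk; rewrite (_ : laplacian p =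
  'D_((1, 0) : R * R) ('D_((1, 0) : R * R) p) +
  'D_((0, 1) : R * R) ('D_((0, 1) : R * R) p)) //.
by apply: polyfunD; exact/polyfun_derive/polyfun_derive.
Qed.

(** The truncated bound [k.-2] hides that affine functions are harmonic. Degrees 0 and 1 need this
    fact, since surjectivity of the Laplacian would return a polynomial of too high a degree
    there. *)
Lemma laplacian_polyfun1 k p : (k <= 1)%N -> polyfun k p -> laplacian p = 0.
Proof.
move=> k1 pk; apply/funext => z; rewrite /laplacian.
have D0 v : polyfun 0 ('D_v p).
  by apply: polyfunW (polyfun_derive v pk); lia.
have DD v w : 'D_v ('D_w p) z = 0 by exact: polyfun0_derive.
by rewrite (DD (1, 0) (1, 0)) (DD (0, 1) (0, 1)) addr0.
Qed.

(** The Laplacian of [x^i y^(j+2) / ((j+2)(j+1))] is [x^i y^j] plus a multiple of [x^(i-2) y^(j+2)].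
    The error has the same total degree but a smaller power of [x], so induction on the bound [n]
    for that power removes it. *)
Lemma laplacian_onto_mono n i j : (i <= n)%N ->
  exists2 p : R * R -> R, polyfun (i + j + 2) p & laplacian p = mono i j.
Proof.
elim: n i j => [|n ih] i j iN.
all: pose q := ((j.+2 * j.+1)%:R^-1 : R) *: mono i j.+2.
all: have qk : polyfun (i + j + 2) q by apply/polyfunZ/polyfun_mono; lia.
all: have qE z : laplacian q z =
  (j.+2 * j.+1)%:R^-1 * (i * i.-1)%:R * mono i.-2 j.+2 z + mono i j z
  by rewrite (@laplacianZ (i + j.+2))  ?laplacian_mono; [|exact: polyfun_mono];
     rewrite /= mulrDr !mulrA mulVf ?mul1r // pnatr_eq0.
  exists q => //; apply/funext => z; rewrite qE.
  by move: iN; rewrite leqn0 => /eqP ->; rewrite mul0n mulr0 mul0r add0r.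
(* For [i] equal to 0 or 1 the factor [i * i.-1] is zero and no error term has to be corrected. *)
have [i1|i1] := leqP i 1.
  exists q => //; apply/funext => z; rewrite qE.
  by rewrite (_ : i * i.-1 = 0)%N ?mulr0 ?mul0r ?add0r//; lia.
have [|r rk rE] := ih i.-2 j.+2; first lia.
have rk' : polyfun (i + j + 2) r by apply: polyfunW rk; lia.
exists (q + (- ((j.+2 * j.+1)%:R^-1 * (i * i.-1)%:R) : R) *: r).
  by apply: polyfunD => //; exact: polyfunZ.
apply/funext => z; rewrite (@laplacianD (i + j + 2))//; last exact: polyfunZ.
by rewrite qE (@laplacianZ (i + j + 2))// rE mulNr addrAC subrr add0r.
Qed.

Lemma laplacian_onto k (r : R * R -> R) : polyfun k r ->
  exists2 p, polyfun (k + 2) p & laplacian p = r.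
Proof.
move: r; apply: polyfun_ind.
- by exists 0; [exact: polyfun0|apply/funext => z; exact: laplacian0].
- move=> _ _ [p pk <-] [q qk <-]; exists (p + q); first exact: polyfunD.
  by apply/funext => z; rewrite (laplacianD _ pk qk).
- move=> a _ [p pk <-]; exists (a *: p); first exact: polyfunZ.
  by apply/funext => z; rewrite (laplacianZ _ _ pk).
- move=> i j ijk; have [p pk pE] := @laplacian_onto_mono i i j (leqnn i).
  by exists p => //; apply: polyfunW pk; lia.
Qed.

(** * Affine inverses and the moment recurrences of a triangle *)

Definition det2 (a b : R * R) : R := a.1 * b.2 - a.2 * b.1.

(** Cramer's rule, with the coefficients of the inverse exhibited because triangles are later cut
    out by its affine coordinates. *)
Lemma affine_map_inverse (F : R * R -> R * R) c u w :
  (forall z, F z = c + z.1 *: u + z.2 *: w) -> det2 u w != 0 ->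
  exists G, [/\ exists c' u' w', forall z, G z = c' + z.1 *: u' + z.2 *: w',
      cancel F G & cancel G F].
Proof.
rewrite /det2 => FE; move: u w c FE => [u1 u2] [w1 w2] [c1 c2] FE /= d0.
pose D := u1 * w2 - u2 * w1; rewrite -/D in d0.
exists (fun z => ((w2 * (z.1 - c1) - w1 * (z.2 - c2)) / D,
                  (u1 * (z.2 - c2) - u2 * (z.1 - c1)) / D)).
split.
- exists ((- w2 * c1 + w1 * c2) / D, (u2 * c1 - u1 * c2) / D),
    (w2 / D, - u2 / D), (- w1 / D, u1 / D).
  by move=> [z1 z2]; apply: pair_ext; rewrite /= /GRing.scale/=; ring.
- move=> [z1 z2]; rewrite FE; apply: pair_ext => /=;
    rewrite /GRing.scale/= /D in d0 *; field; exact: d0.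
- move=> [z1 z2]; rewrite FE; apply: pair_ext => /=;
    rewrite /GRing.scale/= /D in d0 *; field; exact: d0.
Qed.

(* The two recurrences express that the integrals over the reference triangle
   of d/dx (x^(i+1) y^j (1 - x - y)) and d/dy (x^i y^(j+1) (1 - x - y))
   vanish. *)
Definition triangle_moments (m : nat -> nat -> R) : Prop := forall i j,
  i.+1%:R * m i j - i.+2%:R * m i.+1 j - i.+1%:R * m i j.+1 = 0 /\
  j.+1%:R * m i j - j.+1%:R * m i.+1 j - j.+2%:R * m i j.+1 = 0.

(** As a linear system in the two next moments, the recurrences have determinant
    [(i+2)(j+2) - (i+1)(j+1) = i+j+3], which is never zero; the multiplied equations are the
    elimination steps. *)
Lemma triangle_momentsE m : triangle_moments m -> forall i j,
  (i + j + 3)%:R * m i.+1 j = i.+1%:R * m i j /\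
  (i + j + 3)%:R * m i j.+1 = j.+1%:R * m i j.
Proof.
move=> mE i j; have [] := mE i j.
rewrite !natrD -!natr1 => e1 e2.
have f1 := congr1 ( *%R (j%:R + 2)) e1; have f2 := congr1 ( *%R (i%:R + 1)) e2.
have g1 := congr1 ( *%R (j%:R + 1)) e1; have g2 := congr1 ( *%R (i%:R + 2)) e2.
by split; lra.
Qed.

(** Every moment is reached from the zeroth one by the solved recurrences, so two solutions are
    proportional. The cross-multiplied form avoids dividing by a zeroth moment that might be
    zero. *)
Lemma triangle_moments_unique m m' :
  triangle_moments m -> triangle_moments m' ->
  forall i j, m i j * m' 0%N 0%N = m' i j * m 0%N 0%N.
Proof.
move=> /triangle_momentsE mE /triangle_momentsE mE'.
have n0 i j : (i + j + 3)%:R != 0 :> R by rewrite pnatr_eq0; lia.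
elim=> [|i ih] j.
  elim: j => [|j ih]; first by rewrite mulrC.
  apply: (mulfI (n0 0 j)%N); rewrite !mulrA.
  by rewrite (mE 0 j)%N.2 (mE' 0 j)%N.2 -!mulrA ih.
apply: (mulfI (n0 i j)); rewrite !mulrA.
by rewrite (mE i j).1 (mE' i j).1 -!mulrA ih.
Qed.

Lemma triangle_moments_eq0 m : triangle_moments m -> m 0%N 0%N = 0 ->
  forall i j, m i j = 0.
Proof.
move=> /triangle_momentsE mE m0.
have n0 i j : (i + j + 3)%:R != 0 :> R by rewrite pnatr_eq0; lia.
elim=> [|i ih] j.
  elim: j => [//|j ih].
  by apply: (mulfI (n0 0 j)%N); rewrite (mE 0 j)%N.2 ih !mulr0.
by apply: (mulfI (n0 i j)); rewrite (mE i j).1 ih !mulr0.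
Qed.

End PolyfunDerive.

Arguments polyfun_derivable {R} z v {k p}.

(** * Discarding null sets from the domain of integration *)

Section NullSets.
Context d (T : measurableType d) (R : realType).
Variable mu : {measure set T -> \bar R}.
Local Open Scope ereal_scope.
Import HBNNSimple.

(** Without measurability of [f], the argument goes back to the integral as a supremum over simple
    functions and compares the two families. *)
Lemma ge0_integral_setD_null (D N : set T) (f : T -> \bar R) :
  measurable N -> mu N = 0 -> (forall x, D x -> 0 <= f x) ->
  \int[mu]_(x in D) f x = \int[mu]_(x in D `\` N) f x.
Proof.
move=> mN N0 f0; have f0' x : (D `\` N) x -> 0 <= f x by move=> [/f0].
have mNC : measurable (~` N) by exact: measurableC.
rewrite !ge0_integralE//; apply/eqP; rewrite eq_le; apply/andP; split.
- apply: ge_ereal_sup => _ [g /= gf <-]; apply: ereal_sup_ubound => /=.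
  (* Multiplying [g] by the indicator of the complement of [N] keeps its integral, since [N] is
     null, and puts it below the restriction of [f] to the smaller set. *)
  exists (proj_nnsfun g mNC).
    move=> x; rewrite -mrestrict /patch in_setD in_setC.
    have := gf x; rewrite /patch.
    by case: (x \in N) => /=; rewrite ?andbT// andbF.
  rewrite -mrestrict -integral_nnsfun// -setTD.
  rewrite -ge0_negligible_integral ?integralT_nnsfun//.
    exact/measurable_EFinP/measurable_funP.
  by move=> x _; rewrite lee_fin.
- apply: ge_ereal_sup => _ [g /= gf <-]; apply: ereal_sup_ubound => /=.
  (* Conversely, since [f] is nonnegative on [D], its restriction to the smaller set lies below its
     restriction to [D]. *)
  exists g => // x; apply: le_trans (gf x) _.
  rewrite /patch in_setD; case: ifPn => [/andP[-> _]//|_].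
  by case: ifPn => // /set_mem /f0.
Qed.

(* [f] need not be measurable: the gradients in the bilinear forms take
   unspecified values on the mesh skeleton. *)
Lemma integral_setD_null (D N : set T) (f : T -> \bar R) :
  measurable N -> mu N = 0 ->
  \int[mu]_(x in D) f x = \int[mu]_(x in D `\` N) f x.
Proof.
move=> mN N0; rewrite integralE [RHS]integralE.
by congr (_ - _); apply: ge0_integral_setD_null.
Qed.

End NullSets.

Lemma Rintegral_setD_null d (T : measurableType d) (R : realType)
    (mu : {measure set T -> \bar R}) (D N : set T) (f : T -> R) :
  measurable N -> mu N = 0%E ->
  \int[mu]_(x in D) f x = \int[mu]_(x in D `\` N) f x.
Proof. by move=> mN N0; rewrite /Rintegral (integral_setD_null _ _ mN N0). Qed.

(** * Integrability of polynomials on bounded measurable sets *)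

Section Plane.
Variable R : realType.
Notation mu := (@lebesgue_measure R).
Notation mu2 := (lebesgue2 R).

Lemma measurable_polyfun k (p : R * R -> R) (D : set (R * R)) : polyfun k p ->
  measurable_fun (D : set (measurableTypeR R * measurableTypeR R)) p.
Proof.
move=> pk; apply: (@measurable_funS _ _ _ _ setT) => //.
move: p pk; apply: polyfun_ind => [|p q mp mq|a p mp|i j _].
- exact: measurable_cst.
- exact: measurable_funD.
- exact: measurable_funM.
- by apply: measurable_funM; apply: measurable_funX;
    [exact: measurable_fst|exact: measurable_snd].
Qed.

Definition box (M : R) : set (R * R) :=
  [set z | `|z.1| <= M /\ `|z.2| <= M].

Lemma bounded_polyfun k (p : R * R -> R) M : polyfun k p ->
  exists C, forall z, box M z -> `|p z| <= C.
Proof.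
move: p; apply: polyfun_ind => [|p q [C pC] [D qD]|a p [C pC]|i j _].
- by exists 0 => z _; rewrite normr0.
- exists (C + D) => z Mz; rewrite addrfctE (le_trans (ler_normD _ _))//.
  by rewrite lerD ?pC ?qD.
- by exists (`|a| * C) => z Mz; rewrite scale_funE normrM ler_wpM2l ?pC.
- exists (M ^+ i * M ^+ j) => z [z1 z2]; rewrite normrM !normrX.
  by rewrite ler_pM ?exprn_ge0// lerXn2r ?nnegrE// (le_trans _ z1) ?(le_trans
    _ z2).
Qed.

Lemma boxE M : box M = `[- M, M] `*` `[- M, M].
Proof.
by apply/seteqP; split => -[x y]; rewrite /box/= !in_itv/= !ler_norml.
Qed.

Lemma measurable_box M :
  measurable (box M : set (measurableTypeR R * measurableTypeR R)).
Proof. by rewrite boxE; apply: measurableX; exact: measurable_itv. Qed.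

Lemma lebesgue2_box M : (mu2 (box M) < +oo)%E.
Proof.
rewrite boxE [X in (X < _)%E](_ : _ = mu `[(- M)%R, M] * mu `[(- M)%R, M])%E.
  rewrite lebesgue_measure_itv/=; case: ifP => _; last by rewrite mul0e ltry.
  by rewrite -EFinB -EFinM ltry.
by apply: product_measure1E; exact: measurable_itv.
Qed.

Lemma integrable_polyfun k (p : R * R -> R) M
    (K : set (measurableTypeR R * measurableTypeR R)) :
  polyfun k p -> measurable K -> K `<=` box M ->
  mu2.-integrable K (EFin \o p).
Proof.
move=> pk mK KM; apply: measurable_bounded_integrable => //.
- apply: le_lt_trans (lebesgue2_box M).
  by apply: le_measure; rewrite ?inE//; exact: measurable_box.
- exact: measurable_polyfun pk.
- have [C pC] := bounded_polyfun M pk; exists C; split; first exact: num_real.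
  by move=> x Cx z Kz; apply: le_trans (ltW Cx); exact/pC/KM.
Qed.

End Plane.

(** * Directional derivatives along lines *)

Section DeriveLine.
Variables (R : realType) (V V' : normedModType R).

(** When [A] carries a line affinely to a line, the two difference quotients are the same function
    of [t]; the derivative rules that follow thus need no chain rule. *)
Lemma difference_quotient_comp (A : V -> V') (f : V' -> R) z v v' :
  (forall t : R, A (t *: v + z) = t *: v' + A z) ->
  (fun t : R => t^-1 *: ((f \o A \o shift z) (t *: v) - (f \o A) z)) =
  (fun t : R => t^-1 *: ((f \o shift (A z)) (t *: v') - f (A z))).
Proof. by move=> AE; apply/funext => t /=; rewrite AE. Qed.

Lemma derive_comp_line (A : V -> V') (f : V' -> R) z v v' :
  (forall t : R, A (t *: v + z) = t *: v' + A z) ->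
  'D_v (f \o A) z = 'D_v' f (A z).
Proof. by move=> AE; rewrite /derive (difference_quotient_comp f AE). Qed.

Lemma derivable_comp_line (A : V -> V') (f : V' -> R) z v v' :
  (forall t : R, A (t *: v + z) = t *: v' + A z) ->
  derivable f (A z) v' -> derivable (f \o A) z v.
Proof. by move=> AE; rewrite /derivable (difference_quotient_comp f AE). Qed.

End DeriveLine.

(** * The fundamental theorem of calculus on closed intervals *)

Section Interval.
Variable R : realType.
Notation mu := (@lebesgue_measure R).

Lemma closed_interval_itvcc (S : set R) : closed S -> is_interval S ->
  S !=set0 -> has_ubound S -> has_lbound S -> S = `[inf S, sup S]%classic.
Proof.
move=> cS iS S0 uS lS.
have supS : S (sup S).
  apply: cS => B /nbhs_ballP[e /= e0 eB].
  have [x Sx xe] := sup_adherent e0 (conj S0 uS); exists x; split=> //.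
  by apply: eB; rewrite /ball/= ger0_norm ?subr_ge0 ?ub_le_sup//; lra.
have infS : S (inf S).
  apply: cS => B /nbhs_ballP[e /= e0 eB].
  have [x Sx xe] := inf_adherent e0 (conj S0 lS); exists x; split=> //.
  by apply: eB; rewrite /ball/= distrC ger0_norm ?subr_ge0 ?ge_inf//; lra.
apply/seteqP; split => x.
  by move=> Sx; rewrite /= in_itv/= ge_inf// ub_le_sup.
by rewrite /= in_itv/= => /(iS _ _ infS supS).
Qed.

(** [S] is a compact interval whose endpoints are not interior, so [g] vanishes there and the
    fundamental theorem gives zero. The empty set and a single point are treated apart. *)
Lemma integral_derivative_vanishing (S : set R) (g g' : R -> R) :
  closed S -> is_interval S -> has_ubound S -> has_lbound S ->
  (forall x : R, is_derive x (1 : R) g (g' x)) -> continuous g' ->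
  (forall x, S x -> ~ interior S x -> g x = 0) ->
  (\int[mu]_(x in S) (g' x)%:E = 0)%E.
Proof.
move=> cS iS uS lS dg cg' g0.
have [->|/set0P S0] := eqVneq S set0; first by rewrite integral_set0.
have SE := closed_interval_itvcc cS iS S0 uS lS.
have ab : inf S <= sup S by case: S0 => x Sx;
  rewrite (le_trans (ge_inf lS Sx))// ub_le_sup.
move: (inf S) (sup S) SE ab => a b SE ab.
have ga : g a = 0.
  apply: g0; rewrite SE; first by rewrite /= in_itv/= lexx.
  by rewrite interior_itv_bnd /= in_itv/= ltxx.
have gb : g b = 0.
  apply: g0; rewrite SE; first by rewrite /= in_itv/= lexx andbT.
  by rewrite interior_itv_bnd /= in_itv/= ltxx andbF.
rewrite SE; move: ab; rewrite le_eqVlt => /predU1P[->|ab].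
  by rewrite set_itv1 integral_set1.
have cg x : {for x, continuous g}.
  by apply: differentiable_continuous; apply/derivable1_diffP; have [] := dg x.
rewrite (@continuous_FTC2 _ g' g a b)//.
- by rewrite ga gb subee.
- exact: continuous_subspaceT.
- split.
  + by move=> x _; have [] := dg x.
  + exact/cvg_at_right_filter/cg.
  + exact/cvg_at_left_filter/cg.
- by move=> x _; rewrite derive1E derive_val.
Qed.

End Interval.

(** * Divergence theorem for polynomials vanishing on the boundary *)

Section PlaneDivergence.
Variable R : realType.
Notation mu := (@lebesgue_measure R).
Notation mu2 := (lebesgue2 R).
Variables (M : R) (K : set (measurableTypeR R * measurableTypeR R)).
Hypotheses (mK : measurable K) (cK : closed (K : set (R * R))) (KM : K `<=`
  @box R M).
Hypotheses (K1 : forall y, is_interval [set x | K (x, y)])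
           (K2 : forall x, is_interval [set y | K (x, y)]).
Variables (k : nat) (p : R * R -> R).
Hypotheses (pk : polyfun k p)
  (p0 : forall z, K z -> ~ interior (K : set (R * R)) z -> p z = 0).

Lemma continuous_pair_l (y : R) : continuous (fun x : R => (x, y)).
Proof. by move=> x; exact: (cvg_pair cvg_id (cvg_cst y)). Qed.

Lemma continuous_pair_r (x : R) : continuous (fun y : R => (x, y)).
Proof. by move=> y; exact: (cvg_pair (cvg_cst x) cvg_id). Qed.

Lemma integral_section1 y :
  (\int[mu]_(x in [set x | K (x, y)]) ('D_((1, 0) : R * R) p (x, y))%:E = 0)%E.
Proof.
apply: (@integral_derivative_vanishing _ _ (fun x => p (x, y))) => //.
- by move/continuous_closedP : (@continuous_pair_l y); apply.
- by exists M => x /KM[/= /ler_normlP[]].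
- by exists (- M) => x /KM[/=]; rewrite ler_norml => /andP[].
- move=> x; have H (t : R) : (t *: 1 + x, y) = t *: (1, 0) + (x, y).
    by apply: pair_ext; rewrite /= /GRing.scale/= ?mulr0 ?add0r.
  apply: DeriveDef.
    by apply: (derivable_comp_line H); exact: (polyfun_derivable _ _ pk).
  exact: (derive_comp_line p H).
- move=> x; have c := polyfun_continuous (polyfun_derive (1, 0) pk).
  exact: (continuous_comp (@continuous_pair_l y x) (c (x, y))).
(* If [(x, y)] were interior to [K], continuity of the horizontal embedding would make [x] interior
   to the slice; so ends of slices are boundary points of [K]. *)
- move=> x Kx nK; apply: p0 => // iK; apply: nK.
  exact: (continuous_pair_l iK).
Qed.

Lemma integral_section2 x :
  (\int[mu]_(y in [set y | K (x, y)]) ('D_((0, 1) : R * R) p (x, y))%:E = 0)%E.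
Proof.
apply: (@integral_derivative_vanishing _ _ (fun y => p (x, y))) => //.
- by move/continuous_closedP : (@continuous_pair_r x); apply.
- by exists M => y /KM[/= _ /ler_normlP[]].
- by exists (- M) => y /KM[/= _]; rewrite ler_norml => /andP[].
- move=> y; have H (t : R) : (x, t *: 1 + y) = t *: (0, 1) + (x, y).
    by apply: pair_ext; rewrite /= /GRing.scale/= ?mulr0 ?add0r.
  apply: DeriveDef.
    by apply: (derivable_comp_line H); exact: (polyfun_derivable _ _ pk).
  exact: (derive_comp_line p H).
- move=> y; have c := polyfun_continuous (polyfun_derive (0, 1) pk).
  exact: (continuous_comp (@continuous_pair_r x y) (c (x, y))).
- move=> y Ky nK; apply: p0 => // iK; apply: nK.
  exact: (continuous_pair_r iK).
Qed.

(** Fubini with the [x]-integral innermost: every horizontal slice contributes zero. Extension by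
    zero turns the integral over [K] into one over the plane. *)
Lemma integral_derive1 :
  (\int[mu2]_(z in K) ('D_((1, 0) : R * R) p z)%:E = 0)%E.
Proof.
have pk' := polyfun_derive (1, 0) pk.
have := integrable_polyfun pk' mK KM => /(integrable_mkcond _ mK) ip.
rewrite integral_mkcond -(integral21_prod_meas1 ip) /fubini_G.
rewrite (eq_integral (cst 0%E)) ?integral0// => y _.
rewrite -(integral_section1 y) [RHS]integral_mkcond.
apply: eq_integral => x _; rewrite /patch.
by congr (if _ then _ else _); apply/idP/idP; rewrite !inE.
Qed.

Lemma integral_derive2 :
  (\int[mu2]_(z in K) ('D_((0, 1) : R * R) p z)%:E = 0)%E.
Proof.
have pk' := polyfun_derive (0, 1) pk.
have := integrable_polyfun pk' mK KM => /(integrable_mkcond _ mK) ip.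
rewrite integral_mkcond -(integral12_prod_meas1 ip) /fubini_F.
rewrite (eq_integral (cst 0%E)) ?integral0// => x _.
rewrite -(integral_section2 x) [RHS]integral_mkcond.
apply: eq_integral => y _; rewrite /patch.
by congr (if _ then _ else _); apply/idP/idP; rewrite !inE.
Qed.

Lemma Rintegral_derive v : \int[mu2]_(z in K) 'D_v p z = 0.
Proof.
rewrite (derive_polyfunE v pk).
have i1 := integrable_polyfun (polyfunZ v.1 (polyfun_derive (1, 0) pk)) mK KM.
have i2 := integrable_polyfun (polyfunZ v.2 (polyfun_derive (0, 1) pk)) mK KM.
rewrite (RintegralD mK i1 i2).
rewrite RintegralZl//; last exact: integrable_polyfun (polyfun_derive (1, 0)
  pk) mK KM.
rewrite RintegralZl//; last exact: integrable_polyfun (polyfun_derive (0, 1)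
  pk) mK KM.
by rewrite /Rintegral integral_derive1 integral_derive2 /= !mulr0 addr0.
Qed.

End PlaneDivergence.

(** * Removing a cutoff by dominated convergence *)

Section Cutoff.
Context d (T : measurableType d) (R : realType).
Variable mu : {measure set T -> \bar R}.

(** As [0 <= l < 1], the powers [l ^+ n] tend to 0 pointwise while [|f|] dominates, so the integral
    of [f] is the limit of the vanishing ones. *)
Lemma Rintegral_eq0_cutoff (D : set T) (f l : T -> R) :
  measurable D -> mu.-integrable D (EFin \o f) -> measurable_fun D l ->
  (forall x, D x -> 0 <= l x < 1) ->
  (forall n, \int[mu]_(x in D) (f x * (1 - l x ^+ n)) = 0) ->
  \int[mu]_(x in D) f x = 0.
Proof.
move=> mD fi ml l01 fn0.
have mf : measurable_fun D f by apply/measurable_EFinP;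
  exact: measurable_int fi.
pose g n x := (f x * (1 - l x ^+ n))%:E.
have mg n : measurable_fun D (g n).
  apply/measurable_EFinP/measurable_funM => //; apply: measurable_funB => //.
  exact: measurable_funX.
have le_g n x : D x -> (`|g n x| <= `|f x|%:E)%E.
  move=> Dx; rewrite /g abse_EFin lee_fin normrM ler_piMr//.
  have /andP[l0 l1] := l01 _ Dx.
  have ln0 : 0 <= l x ^+ n by exact: exprn_ge0.
  have ln1 : l x ^+ n <= 1 by apply: exprn_ile1 => //; exact: ltW.
  by rewrite ger0_norm; lra.
have cvg_g x : D x -> g n x @[n --> \oo] --> (f x)%:E.
  move=> Dx; have /andP[l0 l1] := l01 _ Dx.
  apply: cvg_EFin; first by near=> n.
  rewrite -[X in _ --> X]mulr1; apply: cvgM; first exact: cvg_cst.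
  rewrite -[X in _ --> X]subr0; apply: cvgB; first exact: cvg_cst.
  by apply: cvg_expr; rewrite ger0_norm.
have [_ _ ] := @dominated_convergence _ _ _ mu D mD g (EFin \o f)
  (fun x => `|f x|%:E) mg ((measurable_EFinP _ _).2 mf) (aeW _ cvg_g)
  (integrable_norm fi) (aeW _ (fun x n => @le_g n x)).
rewrite (_ : (fun n => _) = cst 0%E); last first.
  apply/funext => n /=.
  have ig : mu.-integrable D (g n).
    exact: (@le_integrable _ _ _ mu D mD (g n) (EFin \o f) (mg n) (@le_g n) fi).
  by rewrite -(fineK (integrable_fin_num mD ig)); congr EFin; exact: fn0.
by move=> /cvg_lim; rewrite lim_cst// => /(_ (@ereal_hausdorff
  _))/esym/(congr1 fine).
Unshelve. all: by end_near.
Qed.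

End Cutoff.

(** * Lines are null sets *)

Section Lines.
Variable R : realType.
Notation mu := (@lebesgue_measure R).
Notation mu2 := (lebesgue2 R).

(** Two different values exclude a constant [g]. Its zero set is then either a vertical line, a
    product with a null factor, or a set meeting each vertical line in a single point. *)
Lemma null_affine_zeros k (g : R * R -> R) (a s t : R) z1 z2 : polyfun k g ->
  (forall z, g z = a + z.1 * s + z.2 * t) -> g z1 != g z2 ->
  mu2 (g @^-1` [set 0]) = 0%E.
Proof.
move=> pg gE; rewrite !gE => g12.
have [t0|t0] := eqVneq t 0.
  have s0 : s != 0 by apply: contraNneq g12 => ->; rewrite t0 !mulr0.
  have -> : g @^-1` [set 0] = [set - a / s] `*` setT.
    apply/seteqP; split => -[x y]; rewrite /= gE/= t0 mulr0 addr0.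
      move=> e; split => //; apply: (mulIf s0); rewrite mulfVK//.
      by apply/eqP; rewrite -addr_eq0 addrC e.
    by move=> [-> _]; rewrite mulfVK// subrr.
  transitivity (mu [set (- a / s)%R] * mu setT)%E.
    by apply: product_measure1E => //; exact: measurable_set1.
  by rewrite lebesgue_measure_set1 mul0e.
rewrite /lebesgue2 /= /product_measure1; apply: integral0_eq => x _ /=.
apply: (@subset_measure0 _ _ _ mu _ [set - (a + x * s) / t]).
- apply: measurable_xsection.
  rewrite -[X in measurable X]setTI.
  by apply: (measurable_polyfun (D := setT) pg) => //; exact: measurable_set1.
- exact: measurable_set1.
- move=> y; rewrite /xsection/= inE /= gE/= => e; apply: (mulIf t0).
  by rewrite mulfVK//; apply/eqP; rewrite -addr_eq0 addrC e.
- exact: lebesgue_measure_set1.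
Qed.

End Lines.

(** * Affine triangles: geometry, Green's formula and moments *)

Section AffineTriangle.
Variable R : realType.
Notation mu2 := (lebesgue2 R).

(** An explicit open replacement for the interior, in which membership is settled by arithmetic. *)
Definition open_ref_triangle : set (R * R) :=
  [set z | [/\ 0 < z.1, 0 < z.2 & 0 < 1 - z.1 - z.2]].

Variables (F G : R * R -> R * R) (c u w c' u' w' : R * R).
Hypotheses (FE : forall z, F z = c + z.1 *: u + z.2 *: w)
           (GE : forall z, G z = c' + z.1 *: u' + z.2 *: w')
           (FK : cancel F G) (GK : cancel G F).

(** The image of the reference triangle under [F], written as a preimage under the inverse: it is
    cut out by three affine inequalities and inherits closedness and measurability from
    polynomials. *)
Let K : set (measurableTypeR R * measurableTypeR R) := G @^-1` ref_triangle R.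
Let O : set (measurableTypeR R * measurableTypeR R) := G @^-1`
  open_ref_triangle.

Let Gaff : affine_map G. Proof. by exists c', u', w'. Qed.

Let g1 := fun z => (G z).1.
Let g2 := fun z => (G z).2.
Let g3 := fun z => 1 - (G z).1 - (G z).2.

Let pg1 : polyfun 1 g1. Proof. exact: (affine_map_polyfun Gaff).1. Qed.
Let pg2 : polyfun 1 g2. Proof. exact: (affine_map_polyfun Gaff).2. Qed.
Let pg3 : polyfun 1 g3.
Proof.
rewrite (_ : g3 = cst 1 + (-1 : R) *: g1 + (-1 : R) *: g2); last first.
  by apply/funext => z; rewrite 2!addrfctE !scale_funE !mulN1r.
by apply: polyfunD; [apply: polyfunD; [exact: polyfun_cst|]|]; exact: polyfunZ.
Qed.

Let KE : K = g1 @^-1` `[0, +oo[ `&` g2 @^-1` `[0, +oo[ `&` g3 @^-1` `[0, +oo[.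
Proof.
apply/seteqP; split => z; rewrite /K /= !in_itv/= !andbT.
  by case.
by move=> [[]].
Qed.

Let OE : O = g1 @^-1` `]0, +oo[ `&` g2 @^-1` `]0, +oo[ `&` g3 @^-1` `]0, +oo[.
Proof.
apply/seteqP; split => z; rewrite /O /= !in_itv/= !andbT.
  by case.
by move=> [[]].
Qed.

Let measurable_preimage_polyfun k (p : R * R -> R) (A : set R) : polyfun k p ->
  measurable (A : set (measurableTypeR R)) ->
  measurable (p @^-1` A : set (measurableTypeR R * measurableTypeR R)).
Proof.
by move=> /(@measurable_polyfun _ _ _ setT) mp mA;
  rewrite -[X in measurable X]setTI; exact: mp.
Qed.

Lemma measurable_affine_triangle : measurable K.
Proof.
by rewrite KE; apply: measurableI; [apply: measurableI|];
  apply: measurable_preimage_polyfun; eauto; exact: measurable_itv.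
Qed.

Lemma closed_affine_triangle : closed (K : set (R * R)).
Proof.
have H k (p : R * R -> R) : polyfun k p -> closed (p @^-1` `[0, +oo[).
  by move=> /polyfun_continuous/continuous_closedP; apply;
    exact: interval_closed.
by rewrite KE; apply: closedI; [apply: closedI|]; apply: H; eauto.
Qed.

Lemma open_open_affine_triangle : open (O : set (R * R)).
Proof.
have H k (p : R * R -> R) : polyfun k p -> open (p @^-1` `]0, +oo[).
  by move=> /polyfun_continuous/continuousP; apply; exact: interval_open.
by rewrite OE; apply: openI; [apply: openI|]; apply: H; eauto.
Qed.

Lemma open_affine_triangleW : O `<=` K.
Proof. by move=> z [? ? ?]; split; exact: ltW. Qed.

Lemma affine_triangle_box : exists M, K `<=` @box R M.
Proof.
exists (`|c.1| + `|u.1| + `|w.1| + (`|c.2| + `|u.2| + `|w.2|)) => z Kz.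
rewrite -(GK z) FE; case: Kz; move: (G z) => [x y] /= x0 y0 xy.
have H (a b d : R) : `|a + x * b + y * d| <= `|a| + `|b| + `|d|.
  apply: le_trans (ler_normD _ _) _; apply: lerD.
    apply: le_trans (ler_normD _ _) _; apply: lerD => //.
    by rewrite normrM ger0_norm// ler_piMl//; lra.
  by rewrite normrM ger0_norm// ler_piMl//; lra.
by split => /=; apply: le_trans (H _ _ _) _; rewrite ?lerDl ?lerDr ?addr_ge0.
Qed.

Let affine_ge0_between (a b x1 x2 x : R) :
  0 <= a + x1 * b -> 0 <= a + x2 * b -> x1 <= x <= x2 -> 0 <= a + x * b.
Proof.
move=> h1 h2 /andP[x1x xx2]; have [b0|b0] := leP 0 b.
  by apply: le_trans h1 _; rewrite lerD2l ler_wpM2r.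
by apply: le_trans h2 _; rewrite lerD2l ler_wnM2r// ltW.
Qed.

Lemma affine_triangle_interval1 y : is_interval [set x | K (x, y)].
Proof.
move=> x1 x2; rewrite /K /= !GE => -[/= a1 a2 a3] [/= b1 b2 b3] x x12.
split; rewrite ?GE /= /GRing.scale/= in a1 a2 a3 b1 b2 b3 *.
- have := @affine_ge0_between (c'.1 + y * w'.1) u'.1 x1 x2 x.
  have E t : c'.1 + y * w'.1 + t * u'.1 = c'.1 + t * u'.1 + y * w'.1 by ring.
  by rewrite !E; apply.
- have := @affine_ge0_between (c'.2 + y * w'.2) u'.2 x1 x2 x.
  have E t : c'.2 + y * w'.2 + t * u'.2 = c'.2 + t * u'.2 + y * w'.2 by ring.
  by rewrite !E; apply.
- have := @affine_ge0_between (1 - c'.1 - y * w'.1 - c'.2 - y * w'.2) (- u'.1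
  - u'.2) x1 x2 x.
  have E t : 1 - c'.1 - y * w'.1 - c'.2 - y * w'.2 + t * (- u'.1 - u'.2) =
    1 - (c'.1 + t * u'.1 + y * w'.1) - (c'.2 + t * u'.2 + y * w'.2) by ring.
  by rewrite !E; apply.
Qed.

Lemma affine_triangle_interval2 x : is_interval [set y | K (x, y)].
Proof.
move=> y1 y2; rewrite /K /= !GE => -[/= a1 a2 a3] [/= b1 b2 b3] y y12.
split; rewrite ?GE /= /GRing.scale/= in a1 a2 a3 b1 b2 b3 *.
- exact: (affine_ge0_between a1 b1 y12).
- exact: (affine_ge0_between a2 b2 y12).
- have := @affine_ge0_between (1 - c'.1 - x * u'.1 - c'.2 - x * u'.2) (- w'.1
  - w'.2) y1 y2 y.
  have E t : 1 - c'.1 - x * u'.1 - c'.2 - x * u'.2 + t * (- w'.1 - w'.2) =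
    1 - (c'.1 + x * u'.1 + t * w'.1) - (c'.2 + x * u'.2 + t * w'.2) by ring.
  by rewrite !E; apply.
Qed.

Lemma continuous_affine_inverse : continuous G.
Proof.
move=> z; have -> : G = fun z => (g1 z, g2 z) by apply/funext => x;
  exact: surjective_pairing.
by apply: (cvg_pair (polyfun_continuous pg1 (x := z)) (polyfun_continuous pg2
  (x := z))).
Qed.

Lemma affine_triangle_bdry z : K z -> ~ interior (K : set (R * R)) z ->
  bdry (ref_triangle R) (G z).
Proof.
move=> Kz nK; split; first exact: subset_closure.
by move=> iG; apply: nK; exact: (continuous_affine_inverse iG).
Qed.

Lemma affine_triangle_not_interior z : K z -> ~ interior (K : set (R * R)) z ->
  [\/ (G z).1 = 0, (G z).2 = 0 | 1 - (G z).1 - (G z).2 = 0].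
Proof.
move=> Kz nK; have nO : ~ O z.
  move=> Oz; apply: nK; apply: filterS open_affine_triangleW _.
  by apply: open_nbhs_nbhs; split => //; exact: open_open_affine_triangle.
case: Kz => z1 z2 z3.
have [->|n1] := eqVneq (G z).1 0; first by constructor.
have [->|n2] := eqVneq (G z).2 0; first by constructor.
have [->|n3] := eqVneq (1 - (G z).1 - (G z).2) 0; first by constructor.
by case: nO; split; rewrite lt_neqAle eq_sym ?n1 ?n2 ?n3.
Qed.

Lemma Rintegral_affine_triangle_derive k (p : R * R -> R) v : polyfun k p ->
  (forall z, K z -> ~ interior (K : set (R * R)) z -> p z = 0) ->
  \int[mu2]_(z in K) 'D_v p z = 0.
Proof.
have [M KM] := affine_triangle_box => pk p0.
apply: (@Rintegral_derive _ M K measurable_affine_triangle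
  closed_affine_triangle KM
  affine_triangle_interval1 affine_triangle_interval2 _ _ pk p0).
Qed.

Lemma integrable_affine_triangle k (p : R * R -> R) : polyfun k p ->
  mu2.-integrable K (EFin \o p).
Proof.
have [M KM] := affine_triangle_box => pk.
exact: (integrable_polyfun pk measurable_affine_triangle KM).
Qed.

Lemma Rintegral_affine_triangleD k (p q : R * R -> R) :
  polyfun k p -> polyfun k q ->
  \int[mu2]_(z in K) (p + q) z = \int[mu2]_(z in K) p z + \int[mu2]_(z in K) q
    z.
Proof.
move=> pk qk; apply: RintegralD; first exact: measurable_affine_triangle.
  exact: integrable_affine_triangle pk.
exact: integrable_affine_triangle qk.
Qed.

Lemma Rintegral_affine_triangleZ k a (p : R * R -> R) : polyfun k p ->
  \int[mu2]_(z in K) (a *: p) z = a * \int[mu2]_(z in K) p z.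
Proof.
move=> pk; apply: RintegralZl; first exact: measurable_affine_triangle.
exact: integrable_affine_triangle pk.
Qed.

(** Moving along [u] in [K] is moving along the first axis in reference coordinates, so the
    derivative of [W \o G] along [u] is the [x]-derivative of [W]. *)
Let line1 z (t : R) : G (t *: u + z) = t *: (1, 0) + G z.
Proof.
apply: (can_inj FK); rewrite GK FE -{1}(GK z) FE.
by apply: pair_ext; rewrite /= /GRing.scale/=; ring.
Qed.

Let line2 z (t : R) : G (t *: w + z) = t *: (0, 1) + G z.
Proof.
apply: (can_inj FK); rewrite GK FE -{1}(GK z) FE.
by apply: pair_ext; rewrite /= /GRing.scale/=; ring.
Qed.

Definition chart_moment i j := \int[mu2]_(z in K) (mono i j \o G) z.

Let pm i j k : (i + j <= k)%N -> polyfun k (mono i j \o G).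
Proof. by move=> ijk; apply: polyfun_comp_affine => //;
  exact: polyfun_mono. Qed.

Let Rintegral_mono3 i1 j1 i2 j2 i3 j3 (a1 a2 a3 : R) :
  \int[mu2]_(z in K) (a1 *: (mono i1 j1 \o G) + a2 *: (mono i2 j2 \o G)
     + a3 *: (mono i3 j3 \o G)) z =
  a1 * chart_moment i1 j1 + a2 * chart_moment i2 j2 + a3 * chart_moment i3 j3.
Proof.
pose k := (i1 + j1 + (i2 + j2) + (i3 + j3))%N.
have p1 : polyfun k (mono i1 j1 \o G) by apply: pm; lia.
have p2 : polyfun k (mono i2 j2 \o G) by apply: pm; lia.
have p3 : polyfun k (mono i3 j3 \o G) by apply: pm; lia.
rewrite (@Rintegral_affine_triangleD k); last 2 first.
- by apply: polyfunD; exact: polyfunZ.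
- exact: polyfunZ.
rewrite (@Rintegral_affine_triangleD k); [|exact: polyfunZ..].
by rewrite !(@Rintegral_affine_triangleZ k).
Qed.

Let null_zeros (g : R * R -> R) a s t z1 z2 : polyfun 1 g ->
  (forall z, g z = a + z.1 * s + z.2 * t) -> g z1 = 0 -> g z2 = 1 ->
  mu2 (g @^-1` [set 0]) = 0%E.
Proof.
move=> pg gE g0 g1'; apply: (null_affine_zeros (z1 := z1) (z2 := z2) pg gE).
by rewrite g0 g1' eq_sym oner_neq0.
Qed.

Lemma null_fst_affine_chart : mu2 ((fst \o G) @^-1` [set 0]) = 0%E.
Proof.
apply: (@null_zeros _ c'.1 u'.1 w'.1 (F (0, 0)) (F (1, 0)) pg1) => [z||].
- by rewrite /g1 GE.
- by rewrite /g1 FK.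
- by rewrite /g1 FK.
Qed.

Lemma null_snd_affine_chart : mu2 ((snd \o G) @^-1` [set 0]) = 0%E.
Proof.
apply: (@null_zeros _ c'.2 u'.2 w'.2 (F (0, 0)) (F (0, 1)) pg2) => [z||].
- by rewrite /g2 GE.
- by rewrite /g2 FK.
- by rewrite /g2 FK.
Qed.

Lemma null_hyp_affine_chart :
  mu2 ((fun z => 1 - (G z).1 - (G z).2) @^-1` [set 0]) = 0%E.
Proof.
apply: (@null_zeros _ (1 - c'.1 - c'.2) (- u'.1 - u'.2) (- w'.1 - w'.2)
  (F (1, 0)) (F (0, 0)) pg3) => [z||]; rewrite /g3.
- by rewrite GE /= /GRing.scale/=; ring.
- by rewrite FK /= subrr subr0.
- by rewrite FK /= !subr0.
Qed.

(** The zero line of [g] is discarded as a null set; off it [0 <= 1 - g < 1] and the cutoff limit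
    applies. *)
Let Rintegral_cutoff k l (p g : R * R -> R) : polyfun k p -> polyfun l g ->
  mu2 (g @^-1` [set 0]) = 0%E -> (forall z, K z -> 0 <= g z <= 1) ->
  (forall n, \int[mu2]_(z in K) (p z * (1 - (1 - g z) ^+ n)) = 0) ->
  \int[mu2]_(z in K) p z = 0.
Proof.
move=> pp pg g0 g01 H.
have mN : measurable (g @^-1` [set 0] : set (measurableTypeR R *
  measurableTypeR R)).
  by apply: measurable_preimage_polyfun pg _; exact: measurable_set1.
have mK := measurable_affine_triangle.
rewrite (Rintegral_setD_null _ _ mN g0).
apply: (@Rintegral_eq0_cutoff _ _ _ mu2 _ p (fun z => 1 - g z)).
- exact: measurableD.
- by apply: integrableS (integrable_affine_triangle pp) => //;
  exact: measurableD.
- by apply: measurable_funB => //; exact: measurable_polyfun pg.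
- move=> z [Kz gz0]; have /andP[gz1 gz2] := g01 _ Kz.
  by rewrite subr_ge0 gz2 ltrBlDl ltrDr lt_neqAle gz1 eq_sym andbT; apply/eqP.
- by move=> n; rewrite -(Rintegral_setD_null _ _ mN g0).
Qed.

Let polyfun_cutoff k n (g : R * R -> R) : polyfun k g ->
  polyfun (k * n) (cst 1 - (cst 1 - g) ^+ n).
Proof.
have pN l (q : R * R -> R) : polyfun l q -> polyfun l (- q).
  by rewrite -scaleN1r; exact: polyfunZ.
move=> pg; apply: polyfunD; first exact: polyfun_cst.
by apply/pN/polyfunX; apply: polyfunD; [exact: polyfun_cst|exact: pN].
Qed.

Let is_derive_cutoff n (g : R * R -> R) (z v : R * R) : is_derive z v g 0 ->
  is_derive z v (cst 1 - (cst 1 - g) ^+ n) 0.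
Proof.
move=> dg; have d1 := is_derive_cst (1 : R) z v.
apply: is_derive_eq (is_deriveB d1 (is_deriveX n (is_deriveB d1 dg))) _.
by rewrite subr0 scaler0 subr0.
Qed.

(* [p] need not vanish on the edge [y = 0], which is parallel to the
   direction of derivation: the factor [1 - (1 - y)^n] makes it vanish there
   and tends to 1 off that edge. *)
Let Rintegral_derive_chart1 k (p q : R * R -> R) : polyfun k p ->
  (forall z : R * R, is_derive z ((1, 0) : R * R) p (q z)) ->
  (forall z, z.1 = 0 -> p z = 0) -> (forall z, 1 - z.1 - z.2 = 0 -> p z = 0) ->
  \int[mu2]_(z in K) q (G z) = 0.
Proof.
move=> pk dp p1 p3.
have qE : q = 'D_((1, 0) : R * R) p by apply/funext => z; exact/esym/derive_val.
have qk : polyfun k.-1 q by rewrite qE; exact: polyfun_derive.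
apply: (@Rintegral_cutoff _ _ (q \o G) g2 (polyfun_comp_affine Gaff qk) pg2).
- exact: null_snd_affine_chart.
- by move=> z [z1 z2 z3]; rewrite /g2 z2/=; lra.
move=> n; pose W := p * (cst 1 - (cst 1 - snd) ^+ n).
have pW : polyfun (k + 1 * n) W.
  by apply: polyfunM => //; exact/polyfun_cutoff/polyfun_snd.
rewrite -[RHS](@Rintegral_affine_triangle_derive _ (W \o G) u
  (polyfun_comp_affine Gaff pW)).
  congr (Rintegral _ _ _); apply/funext => z;
    rewrite (derive_comp_line W (line1 z)).
  rewrite (derive_val (is_derive := is_deriveM (dp (G z))
    (is_derive_cutoff n (is_derive_snd (G z) (1, 0))))).
  by rewrite scaler0 add0r !fctE /GRing.scale/= mulrC.
move=> z Kz /(affine_triangle_not_interior Kz)[h|h|h]; rewrite /= /W mulrfctE.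
- by rewrite p1 ?mul0r.
- by rewrite !fctE /= h subr0 expr1n subrr mulr0.
- by rewrite p3 ?mul0r.
Qed.

(** The coordinates are exchanged: now [x = 0] is the edge parallel to the direction of derivation,
    and the cutoff acts there. *)
Let Rintegral_derive_chart2 k (p q : R * R -> R) : polyfun k p ->
  (forall z : R * R, is_derive z ((0, 1) : R * R) p (q z)) ->
  (forall z, z.2 = 0 -> p z = 0) -> (forall z, 1 - z.1 - z.2 = 0 -> p z = 0) ->
  \int[mu2]_(z in K) q (G z) = 0.
Proof.
move=> pk dp p1 p3.
have qE : q = 'D_((0, 1) : R * R) p by apply/funext => z; exact/esym/derive_val.
have qk : polyfun k.-1 q by rewrite qE; exact: polyfun_derive.
apply: (@Rintegral_cutoff _ _ (q \o G) g1 (polyfun_comp_affine Gaff qk) pg1).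
- exact: null_fst_affine_chart.
- by move=> z [z1 z2 z3]; rewrite /g1 z1/=; lra.
move=> n; pose W := p * (cst 1 - (cst 1 - fst) ^+ n).
have pW : polyfun (k + 1 * n) W.
  by apply: polyfunM => //; exact/polyfun_cutoff/polyfun_fst.
rewrite -[RHS](@Rintegral_affine_triangle_derive _ (W \o G) w
  (polyfun_comp_affine Gaff pW)).
  congr (Rintegral _ _ _); apply/funext => z;
    rewrite (derive_comp_line W (line2 z)).
  rewrite (derive_val (is_derive := is_deriveM (dp (G z))
    (is_derive_cutoff n (is_derive_fst (G z) (0, 1))))).
  by rewrite scaler0 add0r !fctE /GRing.scale/= mulrC.
move=> z Kz /(affine_triangle_not_interior Kz)[h|h|h]; rewrite /= /W mulrfctE.
- by rewrite !fctE /= h subr0 expr1n subrr mulr0.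
- by rewrite p1 ?mul0r.
- by rewrite p3 ?mul0r.
Qed.

(** The polynomial [x^(i+1) y^j (1 - x - y)] does not vanish on [y = 0] when [j = 0], nor its mirror
    image on [x = 0] when [i = 0]; hence the recourse to the cutoff versions of Green's formula. *)
Lemma chart_moments : triangle_moments chart_moment.
Proof.
move=> i j; split.
- pose W : R * R -> R := mono i.+1 j + (-1 : R) *: mono i.+2 j + (-1 : R) *:
  mono i.+1 j.+1.
  have pW : polyfun (i + j).+2 W.
    by apply: polyfunD; [apply: polyfunD; last apply: polyfunZ|apply: polyfunZ];
      apply: polyfun_mono; lia.
  have W0 z : W z = z.1 ^+ i.+1 * z.2 ^+ j * (1 - z.1 - z.2).
    by rewrite /W !fctE /mono /GRing.scale/= !exprS; ring.
  pose q : R * R -> R := i.+1%:R *: mono i j + (- i.+2%:R) *: mono i.+1 j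
    + (- i.+1%:R) *: mono i j.+1.
  have dW z : is_derive z ((1, 0) : R * R) W (q z).
    have d1 := is_derive_mono i.+1 j z (1, 0).
    have d2 := is_deriveZ (-1 : R) (is_derive_mono i.+2 j z (1, 0)).
    have d3 := is_deriveZ (-1 : R) (is_derive_mono i.+1 j.+1 z (1, 0)).
    apply: is_derive_eq (is_deriveD (is_deriveD d1 d2) d3) _.
    by rewrite /q !fctE /mono /GRing.scale/=; ring.
  have <- : \int[mu2]_(z in K) q (G z) = 0.
    apply: (Rintegral_derive_chart1 pW dW) => z h; rewrite W0 h ?mulr0//.
    by rewrite exprS !mul0r.
  by rewrite [RHS]Rintegral_mono3; ring.
- pose W : R * R -> R := mono i j.+1 + (-1 : R) *: mono i.+1 j.+1 + (-1 : R)
  *: mono i j.+2.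
  have pW : polyfun (i + j).+2 W.
    by apply: polyfunD; [apply: polyfunD; last apply: polyfunZ|apply: polyfunZ];
      apply: polyfun_mono; lia.
  have W0 z : W z = z.1 ^+ i * z.2 ^+ j.+1 * (1 - z.1 - z.2).
    by rewrite /W !fctE /mono /GRing.scale/= !exprS; ring.
  pose q : R * R -> R := j.+1%:R *: mono i j + (- j.+1%:R) *: mono i.+1 j
    + (- j.+2%:R) *: mono i j.+1.
  have dW z : is_derive z ((0, 1) : R * R) W (q z).
    have d1 := is_derive_mono i j.+1 z (0, 1).
    have d2 := is_deriveZ (-1 : R) (is_derive_mono i.+1 j.+1 z (0, 1)).
    have d3 := is_deriveZ (-1 : R) (is_derive_mono i j.+2 z (0, 1)).
    apply: is_derive_eq (is_deriveD (is_deriveD d1 d2) d3) _.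
    by rewrite /q !fctE /mono /GRing.scale/=; ring.
  have <- : \int[mu2]_(z in K) q (G z) = 0.
    apply: (Rintegral_derive_chart2 pW dW) => z h; rewrite W0 h ?mulr0//.
    by rewrite exprS mul0r mulr0 mul0r.
  by rewrite [RHS]Rintegral_mono3; ring.
Qed.

End AffineTriangle.

(** * Change of variables for polynomials and orthogonality of mapped bubbles *)

Section ChangeOfVariables.
Variable R : realType.
Notation mu2 := (lebesgue2 R).

Variables (F G : R * R -> R * R) (c u w c' u' w' : R * R).
Hypotheses (FE : forall z, F z = c + z.1 *: u + z.2 *: w)
           (GE : forall z, G z = c' + z.1 *: u' + z.2 *: w')
           (FK : cancel F G) (GK : cancel G F).

Let K : set (measurableTypeR R * measurableTypeR R) := G @^-1` ref_triangle R.

Let Gaff : affine_map G. Proof. by exists c', u', w'. Qed.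

Let m := chart_moment G.
Let m1 := chart_moment (@id (R * R)).

Let idE (z : R * R) : id z = 0 + z.1 *: (1, 0) + z.2 *: (0, 1).
Proof. by apply: pair_ext; rewrite /= /GRing.scale/=; ring. Qed.

Let idC : cancel (@id (R * R)) id. Proof. by []. Qed.

Let RD := Rintegral_affine_triangleD FE GE GK.
Let RZ := Rintegral_affine_triangleZ FE GE GK.
Let RD1 := Rintegral_affine_triangleD idE idE idC.
Let RZ1 := Rintegral_affine_triangleZ idE idE idC.

Let int0 (A : set (measurableTypeR R * measurableTypeR R)) :
  \int[mu2]_(z in A) (0 : R * R -> R) z = 0.
Proof. by rewrite /Rintegral integral0. Qed.

(** The ratio of the two zeroth moments takes the place of the Jacobian determinant; the
    cross-multiplied form makes sense before either is known to be nonzero. *)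
Lemma Rintegral_affine_triangleE k (g : R * R -> R) : polyfun k g ->
  (\int[mu2]_(z in K) g (G z)) * m1 0%N 0%N =
  (\int[mu2]_(z in ref_triangle R) g z) * m 0%N 0%N.
Proof.
(* The induction carries [polyfun k g] along, since additivity of the integral is available for
   polynomials only. *)
suff: polyfun k g -> polyfun k g /\
    (\int[mu2]_(z in K) g (G z)) * m1 0%N 0%N =
  (\int[mu2]_(z in ref_triangle R) g z) * m 0%N 0%N by move=> + h => /(_ h)[].
move: g; apply: polyfun_ind.
- split; first exact: polyfun0.
  by rewrite [X in X * _ = _](int0 K) [X in _ = X * _]int0 !mul0r.
- move=> p q [pk ep] [qk eq]; split; first exact: polyfunD.
  have e1 := RD (polyfun_comp_affine Gaff pk) (polyfun_comp_affine Gaff qk).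
  have e2 := RD1 pk qk.
  by rewrite [X in X * _ = _]e1 [X in _ = X * _]e2 !mulrDl; congr (_ + _).
- move=> a p [pk ep]; split; first exact: polyfunZ.
  have e1 := RZ a (polyfun_comp_affine Gaff pk).
  have e2 := RZ1 a pk.
  by rewrite [X in X * _ = _]e1 [X in _ = X * _]e2 -!mulrA; congr (_ * _).
- move=> i j ijk; split; first exact: polyfun_mono.
  exact: (triangle_moments_unique (chart_moments FE GE FK GK)
    (chart_moments idE idE idC idC)).
Qed.

(** Meant for its contrapositive: the nonzero integral of the bubble's Laplacian forces a nonzero
    zeroth moment. *)
Lemma Rintegral_ref_triangle_eq0 k (g : R * R -> R) : polyfun k g ->
  m1 0%N 0%N = 0 -> \int[mu2]_(z in ref_triangle R) g z = 0.
Proof.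
move=> pg m0; suff: polyfun k g /\ \int[mu2]_(z in ref_triangle R) g z = 0 by
  case.
move: g pg; apply: polyfun_ind.
- by split; [exact: polyfun0|exact: int0].
- move=> p q [pk ep] [qk eq]; split; first exact: polyfunD.
  by rewrite [LHS](RD1 pk qk) [X in X + _]ep add0r.
- move=> a p [pk ep]; split; first exact: polyfunZ.
  by rewrite [LHS](RZ1 a pk) [X in _ * X]ep mulr0.
- move=> i j ijk; split; first exact: polyfun_mono.
  exact: (triangle_moments_eq0 (chart_moments idE idE idC idC) m0).
Qed.

Lemma orthogonal_bubble_affine k (bhat p : R * R -> R) :
  orthogonal_bubble (k + 2) bhat -> polyfun k p ->
  \int[mu2]_(z in K) dot (grad (bhat \o G) z) (grad p z) = 0.
Proof.
move=> [_ bk b0 bp bflux] pk.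
have m10 : m1 0%N 0%N != 0.
  apply: contraNneq bflux => m10; apply/eqP.
  exact: Rintegral_ref_triangle_eq0 (polyfun_laplacian bk) m10.
have Faff : affine_map F by exists c, u, w.
set B := bhat \o G.
have Bk : polyfun (k + 2) B by exact: polyfun_comp_affine.
have B0 z : K z -> ~ interior (K : set (R * R)) z -> B z = 0.
  by move=> Kz nK; exact/b0/(affine_triangle_bdry GE).
have dp v := polyfun_derive v pk.
(* The terms of the divergence of [B grad p]; the field vanishes on the boundary of [K] together
   with [B]. *)
have W0 v : \int[mu2]_(z in K) 'D_v (B * 'D_v p) z = 0.
  apply: (Rintegral_affine_triangle_derive FE GE GK v (polyfunM Bk (dp v))).
  by move=> z Kz nK; rewrite mulrfctE B0 ?mul0r.
have BL0 : \int[mu2]_(z in K) (B z * laplacian p z) = 0.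
  (* The transported Laplacian has a preimage of degree [k.-2 + 2], which is at most [k] only for
     [k >= 2]; in lower degrees [p] is harmonic and [q = 0] serves. *)
  have [q qk qE] : exists2 q, polyfun k q & laplacian q = laplacian p \o F.
    have [k1|k1] := leqP k 1.
      exists 0; first exact: polyfun0.
      by rewrite (laplacian_polyfun1 k1 pk); apply/funext => z;
        rewrite laplacian0.
    have [q qk qE] := laplacian_onto (polyfun_comp_affine Faff
      (polyfun_laplacian pk)).
    by exists q; [apply: polyfunW qk; lia|exact: qE].
  (* Multiplying by the nonzero zeroth moment puts the claim in the cross-multiplied form of the
     change of variables. *)
  apply: (mulIf m10); rewrite mul0r.
  have pq := polyfunM bk (polyfun_laplacian qk).
  have -> : \int[mu2]_(z in K) (B z * laplacian p z) =
      \int[mu2]_(z in K) (bhat * laplacian q) (G z).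
    by apply: eq_Rintegral => z _; rewrite qE mulrfctE /= GK.
  have e : \int[mu2]_(z in ref_triangle R) (bhat * laplacian q) z = 0.
    by apply: bp; rewrite addnK.
  apply: etrans (Rintegral_affine_triangleE pq) _.
  by rewrite e mul0r.
have p1 v : polyfun (k + 2 + k) ('D_v (B * 'D_v p)).
  by apply: polyfunW (polyfun_derive v (polyfunM Bk (dp v))); lia.
have p2 : polyfun (k + 2 + k) (B * laplacian p).
  by apply: polyfunW (polyfunM Bk (polyfun_laplacian pk)); lia.
(* Product rule: [grad B . grad p] is the divergence of [B grad p] minus [B] times the Laplacian of
   [p]. *)
transitivity (\int[mu2]_(z in K) ('D_((1, 0) : R * R) (B * 'D_((1, 0) : R * R)
  p)
    + 'D_((0, 1) : R * R) (B * 'D_((0, 1) : R * R) p)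
    + (-1 : R) *: (B * laplacian p)) z).
  apply: eq_Rintegral => z _.
  have dM v : 'D_v (B * 'D_v p) z = B z * 'D_v ('D_v p) z + 'D_v p z * 'D_v B z.
    exact: (deriveM (polyfun_derivable z v Bk) (polyfun_derivable z v (dp v))).
  have H (b p11 p22 q1 q2 b1 b2 : R) : b1 * q1 + b2 * q2 =
    b * p11 + q1 * b1 + (b * p22 + q2 * b2) + -1 * (b * (p11 + p22)) by ring.
  apply: etrans (H _ _ _ _ _ _ _) _; congr (_ + _); congr (_ + _);
    exact/esym/dM.
rewrite (RD (polyfunD (p1 _) (p1 _)) (polyfunZ _ p2)) (RD (p1 _) (p1 _)) (RZ _
  p2).
by rewrite [X in X + _ + _]W0 [X in _ + X + _]W0 [X in _ * X]BL0 mulr0 !addr0.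
Qed.

End ChangeOfVariables.

(** * Charts of nondegenerate triangles *)

Section Chart.
Variable R : realType.
Notation mu2 := (lebesgue2 R).
Implicit Types (F G : R * R -> R * R) (t : triangle R).

Definition chart F G : Prop := exists c u w c' u' w',
  [/\ forall z, F z = c + z.1 *: u + z.2 *: w,
      forall z, G z = c' + z.1 *: u' + z.2 *: w', cancel F G & cancel G F].

Lemma affine_chart F c u w : (forall z, F z = c + z.1 *: u + z.2 *: w) ->
  det2 u w != 0 -> exists G, chart F G.
Proof.
move=> FE d0; have [G [[c' [u' [w' GE]]] FK GK]] := affine_map_inverse FE d0.
by exists G, c, u, w, c', u', w'.
Qed.

Lemma sum_ord3 (V : nmodType) (f : 'I_3 -> V) : \sum_i f i = f 0 + f 1 + f (1
  + 1).
Proof.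
rewrite !big_ord_recl big_ord0 addr0 addrA; congr (_ + _ + _); congr f;
  exact: val_inj.
Qed.

Lemma ord3_ind (P : 'I_3 -> Prop) : P 0 -> P 1 -> P (1 + 1) -> forall i, P i.
Proof.
move=> p0 p1 p2 [[|[|[|//]]] i]; [move: p0|move: p1|move: p2]; congr P;
  exact: val_inj.
Qed.

Lemma hullE t z : hull t z <-> exists2 x, ref_triangle R x &
  z = t 0 + x.1 *: (t 1 - t 0) + x.2 *: (t (1 + 1) - t 0).
Proof.
split => [[l [l0 l1 ->]]|[[x y] [/= x0 y0 xy] ->]].
  rewrite sum_ord3 in l1; exists (l 1, l (1 + 1)).
    by split => //=; rewrite -l1 (_ : _ - _ = l 0) //; ring.
  rewrite sum_ord3 (_ : l 0 = 1 - l 1 - l (1 + 1)); last by rewrite -l1; ring.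
  by apply: pair_ext; rewrite /= /GRing.scale/=; ring.
exists (fun i => if i == 0 then 1 - x - y else if i == 1 then x else y); split.
- by apply: ord3_ind.
- by rewrite sum_ord3 /=; ring.
- by rewrite sum_ord3 /=; apply: pair_ext; rewrite /= /GRing.scale/=; ring.
Qed.

Lemma hull_vertex t i : hull t (t i).
Proof.
apply/hullE; move: i; apply: ord3_ind.
- exists (0, 0); first by split => /=; lra.
  by rewrite !scale0r !addr0.
- exists (1, 0); first by split => /=; lra.
  by rewrite scale0r scale1r addr0 (addrC (t 0)) subrK.
- exists (0, 1); first by split => /=; lra.
  by rewrite scale0r scale1r addr0 (addrC (t 0)) subrK.
Qed.

(** The chart built on the vertices, through barycentric coordinates. Its last two clauses keep
    vertices and edges off the open cell, which is what separates neighbouring cells of a mesh. *)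
Lemma triangle_chart t : Defs.nondegenerate t -> exists F G, [/\ chart F G,
  hull t = G @^-1` ref_triangle R,
  forall i, ~ open_ref_triangle (G (t i)) &
  forall i z, edge t i z -> ~ open_ref_triangle (G z)].
Proof.
move=> nt; pose F z := t 0 + z.1 *: (t 1 - t 0) + z.2 *: (t (1 + 1) - t 0).
have [//|G FG] := @affine_chart F _ _ _ (fun=> erefl) _.
have [_ [_ [_ [_ [_ [_ [_ _ FK GK]]]]]]] := FG.
have F0 : t 0 = F (0, 0) by rewrite /F !scale0r !addr0.
have F1 : t 1 = F (1, 0) by rewrite /F scale0r scale1r addr0 (addrC (t 0))
  subrK.
have F2 : t (1 + 1) = F (0, 1) by rewrite /F scale0r scale1r addr0 (addrC (t
  0)) subrK.
exists F, G; split => //.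
- apply/seteqP; split => z /=.
    by move=> /hullE[x rx ->]; rewrite -/(F x) FK.
  by move=> Gz; apply/hullE; exists (G z) => //; rewrite -[LHS]GK.
- apply: ord3_ind; rewrite ?F0 ?F1 ?F2 FK => -[/=]; lra.
- move=> i z [s s01]; move: i; apply: ord3_ind.
  + rewrite add0r => ->; rewrite (_ : _ + _ = F (1 - s, s)) ?FK => [[/=]|];
    first lra.
    by apply: pair_ext; rewrite /= /GRing.scale/=; ring.
  + rewrite (_ : 1 + 1 + 1 = 0 :> 'I_3); last exact: val_inj.
    move=> ->; rewrite (_ : _ + _ = F (0, 1 - s)) ?FK => [[/=]|]; first lra.
    by apply: pair_ext; rewrite /= /GRing.scale/=; ring.
  + rewrite (_ : 1 + 1 + 1 = 0 :> 'I_3) ?add0r; last exact: val_inj.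
    move=> ->; rewrite (_ : _ + _ = F (s, 0)) ?FK => [[/=]|]; first lra.
    by apply: pair_ext; rewrite /= /GRing.scale/=; ring.
Qed.

(** The area determinant of the triangle factors through the linear part of [F], so nondegeneracy
    makes that part invertible and yields an inverse on the whole plane. *)
Lemma bijective_affine_chart F t : Defs.nondegenerate t -> affine_map F ->
  set_bij (ref_triangle R) (hull t) F ->
  exists G, chart F G /\ hull t = G @^-1` ref_triangle R.
Proof.
move=> nt [c [u [w FE]]] [Fh Fi Fs].
have d0 : det2 u w != 0.
  have [x0 _ e0] := Fs _ (hull_vertex t 0).
  have [x1 _ e1] := Fs _ (hull_vertex t 1).
  have [x2 _ e2] := Fs _ (hull_vertex t (1 + 1)).
  apply: contraNneq nt => d0; apply/eqP.
  transitivity (det2 u w * det2 (x1 - x0) (x2 - x0)); last by rewrite d0 mul0r.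
  by rewrite -e0 -e1 -e2 !FE /det2 /= /GRing.scale/=; ring.
have [G FG] := affine_chart FE d0; exists G; split => //.
have [_ [_ [_ [_ [_ [_ [_ _ FK GK]]]]]]] := FG.
apply/seteqP; split => z /=.
  by move=> /Fs[x rx <-]; rewrite FK.
by move=> /Fh; rewrite GK.
Qed.

End Chart.

(** * Gradients of functions that agree on an open set *)

Section LocalDerive.
Variable R : realType.
Notation mu2 := (lebesgue2 R).
Implicit Types (p q f g : R * R -> R).

Lemma derive_eq_on_open (A : set (R * R)) f g z v : open A -> A z ->
  (forall x, A x -> f x = g x) -> 'D_v f z = 'D_v g z.
Proof.
move=> oA Az fg; apply: near_eq_derive; apply: filterS fg _.
exact: open_nbhs_nbhs.
Qed.

Lemma grad_eq_on_open (A : set (R * R)) f g z : open A -> A z ->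
  (forall x, A x -> f x = g x) -> grad f z = grad g z.
Proof.
move=> oA Az fg; rewrite /grad; congr pair; exact: derive_eq_on_open fg.
Qed.

Lemma polyfun_dot_grad k l p q : polyfun k p -> polyfun l q ->
  polyfun (k.-1 + l.-1) (fun z => dot (grad p z) (grad q z)).
Proof.
by move=> pk ql; apply: polyfunD; apply: polyfunM; exact: polyfun_derive.
Qed.

Lemma grad_polyfunD k p q z : polyfun k p -> polyfun k q ->
  grad (p + q) z = grad p z + grad q z.
Proof.
by move=> pk qk; apply: pair_ext;
  exact: (deriveD (polyfun_derivable _ _ pk) (polyfun_derivable _ _ qk)).
Qed.

Lemma grad_polyfunZ k a p z : polyfun k p -> grad (a *: p) z = a *: grad p z.
Proof.
by move=> pk; apply: pair_ext; exact: (deriveZ a (polyfun_derivable _ _ pk)).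
Qed.

End LocalDerive.

(** * The edges of a cell as a null set *)

Section ChartNull.
Variable R : realType.
Notation mu2 := (lebesgue2 R).
Implicit Types (F G : R * R -> R * R) (t : triangle R).

(** Whole lines instead of segments: they are zero sets of affine functions, hence null, and
    removing them from the closed cell leaves only points of the open one. *)
Definition chart_lines G : set (measurableTypeR R * measurableTypeR R) :=
  (fst \o G) @^-1` [set 0] `|` (snd \o G) @^-1` [set 0] `|`
  (fun z => 1 - (G z).1 - (G z).2) @^-1` [set 0].

Lemma chart_lines_null F G : chart F G ->
  measurable (chart_lines G) /\ mu2 (chart_lines G) = 0%E.
Proof.
move=> [c [u [w [c' [u' [w' [FE GE FK GK]]]]]]].
have Gaff : affine_map G by exists c', u', w'.
have [p1 p2] := affine_map_polyfun Gaff.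
have p3 : polyfun 1 (fun z => 1 - (G z).1 - (G z).2).
  rewrite (_ : (fun z => _) = cst 1 + (-1 : R) *: (fst \o G) + (-1 : R) *:
    (snd \o G)).
    by apply: polyfunD; [apply: polyfunD; [exact: polyfun_cst|]|];
      exact: polyfunZ.
  by apply/funext => z; rewrite 2!addrfctE !scale_funE !mulN1r.
have mz (p : R * R -> R) : polyfun 1 p ->
    measurable (p @^-1` [set 0] : set (measurableTypeR R * measurableTypeR R)).
  move=> pp; rewrite -[X in measurable X]setTI.
  by apply: (measurable_polyfun (D := setT) pp) => //; exact: measurable_set1.
have [m1 m2 m3] := And3 (mz _ p1) (mz _ p2) (mz _ p3).
have n1 := null_fst_affine_chart GE FK.
have n2 := null_snd_affine_chart GE FK.
have n3 := null_hyp_affine_chart GE FK.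
split; first by apply: measurableU => //; exact: measurableU.
rewrite /chart_lines measureU0//; last exact: measurableU.
by rewrite measureU0.
Qed.

Lemma chart_open_setD G z : ref_triangle R (G z) -> ~ chart_lines G z ->
  open_ref_triangle (G z).
Proof.
move=> [z1 z2 z3] nz.
have h1 : (G z).1 != 0 by apply/eqP => e; apply: nz; do 2 left.
have h2 : (G z).2 != 0 by apply/eqP => e; apply: nz; left; right.
have h3 : 1 - (G z).1 - (G z).2 != 0 by apply/eqP => e; apply: nz; right.
by split; rewrite lt_neqAle eq_sym ?h1 ?h2 ?h3.
Qed.

(** This lets pointwise gradients, unspecified on edges, be replaced by gradients of polynomials. *)
Lemma Rintegral_hull_eq_open F G (f g : R * R -> R) : chart F G ->
  (forall z, open_ref_triangle (G z) -> f z = g z) ->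
  \int[mu2]_(z in G @^-1` ref_triangle R) f z =
  \int[mu2]_(z in G @^-1` ref_triangle R) g z.
Proof.
move=> FG fg; have [mN N0] := chart_lines_null FG.
rewrite (Rintegral_setD_null _ _ mN N0) [RHS](Rintegral_setD_null _ _ mN N0).
apply: eq_Rintegral => z; rewrite inE => -[Gz nz]; apply: fg.
exact: chart_open_setD.
Qed.

End ChartNull.

(** * Splitting an integral over the domain into cells *)

Section MeshIntegral.
Variables (R : realType) (n : nat) (Omega : set (R * R)) (h : R)
  (T : 'I_n -> triangle R) (hT : triangulation Omega h T).
Notation mu2 := (lebesgue2 R).
Variables (F G : 'I_n -> R * R -> R * R).
Hypotheses (FG : forall i, chart (F i) (G i))
  (hullG : forall i, hull (T i) = G i @^-1` ref_triangle R)
  (vertexG : forall i j, ~ open_ref_triangle (G i (T i j)))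
  (edgeG : forall i j z, edge (T i) j z -> ~ open_ref_triangle (G i z)).

Lemma open_cell i : open (G i @^-1` @open_ref_triangle R).
Proof.
have [_ [_ [_ [c' [u' [w' [_ GE _ _]]]]]]] := FG i.
exact: open_open_affine_triangle GE.
Qed.

Lemma open_cell_hull i z : open_ref_triangle (G i z) -> hull (T i) z.
Proof. by rewrite hullG => -[? ? ?]; split; exact: ltW. Qed.

Lemma open_cell_domain i z : open_ref_triangle (G i z) -> Omega z.
Proof.
move=> Oz; apply: (mesh_inside hT (i := i)).
apply: filterS (@open_cell_hull i) _; apply: open_nbhs_nbhs.
by split => //; exact: open_cell.
Qed.

(** By conformity two distinct cells share nothing, a vertex or an edge of the first, and its open
    cell meets none of these. *)
Lemma open_cell_disjoint i j z : i != j -> open_ref_triangle (G i z) ->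
  ~ hull (T j) z.
Proof.
move=> ij Oz jz; have iz := open_cell_hull Oz.
have ijz : (hull (T i) `&` hull (T j)) z by [].
case: (mesh_conforming hT ij) => [e|[p [q [_ e]]]|[p [q [_ e]]]].
- by rewrite e in ijz.
- by move: ijz Oz; rewrite e => ->; exact: vertexG.
- by move: ijz; rewrite e => /edgeG; apply.
Qed.

Let skeleton : set (measurableTypeR R * measurableTypeR R) :=
  \big[setU/set0]_(i < n) chart_lines (G i).

Let skeleton_null : measurable skeleton /\ mu2 skeleton = 0%E.
Proof.
rewrite /skeleton; elim/big_ind : _ => [|A B [mA A0] [mB B0]|i _].
- by split => //; exact: measure0.
- by split; [exact: measurableU|rewrite measureU0].
- exact: chart_lines_null (FG i).
Qed.

Let skeletonP i z : chart_lines (G i) z -> skeleton z.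
Proof. by move=> Nz; rewrite /skeleton (bigD1 i)//=; left. Qed.

(** Off the null skeleton every point of [Omega] lies in exactly one cell, so the integrand is there
    a sum of polynomials cut off to their cells. *)
Lemma Rintegral_mesh k (f : R * R -> R) (p : 'I_n -> R * R -> R) :
  (forall i, polyfun k (p i)) ->
  (forall i z, open_ref_triangle (G i z) -> f z = p i z) ->
  \int[mu2]_(z in Omega) f z = \sum_i \int[mu2]_(z in hull (T i)) p i z.
Proof.
move=> pk fp; have [mN N0] := skeleton_null.
have ip i : mu2.-integrable (hull (T i)) (EFin \o p i).
  rewrite hullG; have [? [? [? [? [? [? [FE GE FK GK]]]]]]] := FG i.
  exact: (integrable_affine_triangle FE GE GK (pk i)).
have mh i : measurable (hull (T i) : set (measurableTypeR R * measurableTypeR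
  R)).
  rewrite hullG; have [? [? [? [? [? [? [FE GE FK GK]]]]]]] := FG i.
  exact: measurable_affine_triangle GE.
have mD i : measurable (hull (T i) `\` skeleton : set (measurableTypeR R *
  measurableTypeR R)).
  exact: measurableD.
have ipD i : mu2.-integrable (hull (T i) `\` skeleton) (EFin \o p i).
  by apply: integrableS (ip i) => //; exact: subDsetl.
rewrite (Rintegral_setD_null _ _ mN N0) Rintegral_mkcond.
transitivity (\int[mu2]_z (\sum_i (p i \_ (hull (T i) `\` skeleton)) z)).
  apply: eq_Rintegral => z _; rewrite patchE.
  have [zD|zD] := boolP (z \in _ `\` _); last first.
    (* Outside [Omega] the sum must vanish: a point of a cell off the skeleton lies in the open
       cell, hence in [Omega]. *)
    rewrite big1// => i _; rewrite patchE; case: ifPn => // /set_mem[iz nz].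
    case/negP: zD; rewrite inE; split => //.
    apply: (@open_cell_domain i); apply: chart_open_setD;
      first by rewrite hullG in iz.
    by move=> /skeletonP.
  move: zD; rewrite inE => -[Oz nz].
  have : closure Omega z by exact: subset_closure.
  rewrite (mesh_cover hT) => -[i _ iz].
  have oz : open_ref_triangle (G i z).
    apply: chart_open_setD; first by rewrite hullG in iz.
    by move=> /skeletonP.
  rewrite (bigD1 i)//= patchE mem_set// big1 ?addr0 ?(fp i)// => j ji.
  rewrite patchE memNset// => -[jz _]; move: jz.
  by apply: open_cell_disjoint oz; rewrite eq_sym.
have iT i : mu2.-integrable setT (EFin \o (p i \_ (hull (T i) `\` skeleton))).
  by rewrite -restrict_EFin; apply/(integrable_mkcond _ (mD i)).
transitivity (\sum_i \int[mu2]_z (p i \_ (hull (T i) `\` skeleton)) z).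
  rewrite /Rintegral.
  under eq_integral do rewrite -sumEFin.
  rewrite (integral_sum measurableT iT).
  rewrite -(eq_bigr _ (fun i _ => fineK (integrable_fin_num measurableT (iT
    i)))).
  by rewrite sumEFin.
by apply: eq_bigr => i _; rewrite -Rintegral_mkcond -(Rintegral_setD_null _ _
  mN N0).
Qed.

End MeshIntegral.

(** * Cell bubbles and the post-processed solution *)

Lemma cell_bubbleE (R : realType) (bhat : R * R -> R) (F G : R * R -> R * R)
    (t : triangle R) z : set_bij (ref_triangle R) (hull t) F -> cancel F G ->
  hull t z -> cell_bubble bhat F t z = bhat (G z).
Proof.
move=> [_ _ Fs] FK tz; rewrite /cell_bubble patchE mem_set//=; congr bhat.
have Fz : z \in hull t by rewrite inE.
by rewrite -[LHS]FK (surjpK (fun=> 0) Fs Fz).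
Qed.

Lemma cell_bubble_outside (R : realType) (bhat : R * R -> R) (F : R * R -> R *
  R)
    (t : triangle R) z : ~ hull t z -> cell_bubble bhat F t z = 0.
Proof. by move=> tz; rewrite /cell_bubble patchE memNset. Qed.

Theorem mainTheorem4 (R : realType) (Omega : set (R * R))
  (hOmega : polygonal_domain Omega)
  (f : R * R -> R) (hf : (f \_ Omega) \in Lfun (lebesgue2 R) 2%:E)
  (alpha : R * R -> R) (alpha0 : R) (halpha0 : 0 < alpha0)
  (halpha : forall z, closure Omega z -> alpha z = alpha0)
  (k : nat) (hk : (1 <= k)%N)
  (h : R) (hh : h < 1) (n : nat) (T : 'I_n -> triangle R)
  (hT : triangulation Omega h T)
  (sigma : R) (hsigma : 0 < sigma) (hTsr : shape_regular sigma T)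
  (c : R) (hc : 0 < c) (hTqu : quasi_uniform c h T)
  (uh : R * R -> R) (huh : fe_space Omega T k uh)
  (hfem : forall vh, fe_space Omega T k vh ->
     a_form Omega alpha uh vh = l2_form Omega f vh)
  (bhat : R * R -> R) (hbhat : orthogonal_bubble (k + 2) bhat)
  (F : 'I_n -> R * R -> R * R) (hF : forall i, affine_map (F i))
  (hFbij : forall i, set_bij (ref_triangle R) (hull (T i)) (F i))
  (b : 'I_n -> R * R -> R) (hb : forall i, b i = cell_bubble bhat (F i) (T i))
  (hflux : forall i,
     boundary_integral (T i)
       (fun e z => normal_derivative (T i) e (b i) z) != 0) :
  (forall i vh, fe_space Omega T k vh ->
     \int[lebesgue2 R]_(z in hull (T i)) dot (grad (b i) z) (grad vh z) = 0)
  /\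
  (forall vh, fe_space Omega T k vh ->
     a_form Omega alpha (postprocessed T alpha f uh b) vh = l2_form Omega f vh).
Proof.
have nT i := mesh_nondegenerate hT i.
(* Two families of charts occur: those built from the vertices control the geometry of the mesh,
   while the inverses of the given maps [F i] describe the bubbles. *)
have /choice[C HC] : forall i, exists C : (R * R -> R * R) * (R * R -> R * R),
    [/\ chart C.1 C.2, hull (T i) = C.2 @^-1` ref_triangle R,
    forall j, ~ open_ref_triangle (C.2 (T i j)) &
    forall j z, edge (T i) j z -> ~ open_ref_triangle (C.2 z)].
  by move=> i; have [F0 [G0 H]] := triangle_chart (nT i); exists (F0, G0).
pose Fc i := (C i).1; pose Gc i := (C i).2.
have HG i : chart (Fc i) (Gc i) by have [] := HC i.
have hG i : hull (T i) = Gc i @^-1` ref_triangle R by have [] := HC i.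
have vG i j : ~ open_ref_triangle (Gc i (T i j)) by have [_ _ + _] := HC i;
  apply.
have eG i j z : edge (T i) j z -> ~ open_ref_triangle (Gc i z).
  by have [_ _ _ +] := HC i; apply.
have /choice[G0 HG0] : forall i, exists G0, chart (F i) G0 /\
    hull (T i) = G0 @^-1` ref_triangle R.
  by move=> i; exact: (bijective_affine_chart (nT i) (hF i) (hFbij i)).
pose B i := bhat \o G0 i.
have oc i := open_cell HG i.
have och i z := @open_cell_hull _ _ _ _ hG i z.
have bk : polyfun (k + 2) bhat by have [] := hbhat.
have Bk i : polyfun (k + 2) (B i).
  have [[? [? [? [c' [u' [w' [_ GE _ _]]]]]]] _] := HG0 i.
  by apply: polyfun_comp_affine bk; exists c', u', w'.
have bE i z : hull (T i) z -> b i z = B i z.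
  have [[? [? [? [? [? [? [_ _ FK _]]]]]]] _] := HG0 i.
  by rewrite hb; exact: cell_bubbleE.
have b0 i z : ~ hull (T i) z -> b i z = 0.
  by rewrite hb; exact: cell_bubble_outside.
have orth i p : polyfun k p ->
    \int[lebesgue2 R]_(z in hull (T i)) dot (grad (B i) z) (grad p z) = 0.
  have [[? [? [? [? [? [? [FE GE FK GK]]]]]]] ->] := HG0 i.
  exact: (orthogonal_bubble_affine FE GE FK GK hbhat).
split=> [i vh [_ /(_ i)[p pk vp] _]|vh hvh].
  rewrite -(orth i p pk) hG; apply: (Rintegral_hull_eq_open (HG i)) => z oz.
  congr dot; apply: (grad_eq_on_open (oc i) oz) => x ox.
    exact/bE/och.
  exact/vp/och.
(* As [uh] satisfies the equations, it remains to see that the correction does not change the form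
   against [vh]. *)
apply: etrans (hfem vh hvh).
have /choice[p Hp] : forall i, exists p, polyfun k p /\
    forall z, hull (T i) z -> vh z = p z.
  by case: hvh => _ + _ => /[swap] i /(_ i)[p pk vp]; exists p.
have /choice[r Hr] : forall i, exists r, polyfun k r /\
    forall z, hull (T i) z -> uh z = r z.
  by case: huh => _ + _ => /[swap] i /(_ i)[p0 pk vp]; exists p0.
have pk i := (Hp i).1; have vp i := (Hp i).2.
have rk i := (Hr i).1; have ur i := (Hr i).2.
pose gamma i := postproc_coef alpha f uh (T i) (b i).
have disj i j z : i != j -> open_ref_triangle (Gc i z) -> ~ hull (T j) z.
  exact: (open_cell_disjoint hT hG vG eG).
have alphaE i z : open_ref_triangle (Gc i z) -> alpha z = alpha0.
  move=> oz; apply: halpha; rewrite (mesh_cover hT); exists i => //.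
  exact: och.
(* The degree of the bubbles, a common bound for them and for [uh] and [vh] on each cell. *)
pose N := (k + 2)%N.
have rN i : polyfun N (r i) by apply: polyfunW (rk i); rewrite /N; lia.
have pN i : polyfun N (p i) by apply: polyfunW (pk i); rewrite /N; lia.
pose rp i : R * R -> R := fun z => dot (grad (r i) z) (grad (p i) z).
pose bp i : R * R -> R := fun z => dot (grad (B i) z) (grad (p i) z).
have rpk i : polyfun (N.-1 + N.-1) (rp i) by exact: polyfun_dot_grad.
have bpk i : polyfun (N.-1 + N.-1) (bp i) by exact: polyfun_dot_grad.
have e1 : a_form Omega alpha uh vh =
    \sum_i \int[lebesgue2 R]_(z in hull (T i)) (alpha0 *: rp i) z.
  apply: (Rintegral_mesh hT HG hG vG eG (k := N.-1 + N.-1)).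
    by move=> i; exact: polyfunZ.
  move=> i z oz; rewrite (alphaE i)// scale_funE; congr (_ * dot _ _);
    apply: (grad_eq_on_open (oc i) oz) => x ox; first exact/ur/och.
  exact/vp/och.
have e2 : a_form Omega alpha (postprocessed T alpha f uh b) vh =
    \sum_i \int[lebesgue2 R]_(z in hull (T i))
      (alpha0 *: rp i + (alpha0 * gamma i) *: bp i) z.
  apply: (Rintegral_mesh hT HG hG vG eG (k := N.-1 + N.-1)).
    by move=> i; apply: polyfunD; exact: polyfunZ.
  move=> i z oz.
  have -> : grad vh z = grad (p i) z.
    by apply: (grad_eq_on_open (oc i) oz) => x ox; exact/vp/och.
  have -> : grad (postprocessed T alpha f uh b) z =
      grad (r i + gamma i *: B i) z.
    apply: (grad_eq_on_open (oc i) oz) => x ox.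
    (* Inside an open cell the other bubbles vanish, being zero off their own cells, so one term of
       the sum survives. *)
    rewrite /postprocessed (bigD1 i)//= big1 ?addr0 => [|j ji].
      by rewrite (ur i) ?bE//; exact: och.
    by rewrite b0 ?mulr0//; apply: disj ox; rewrite eq_sym.
  rewrite (grad_polyfunD z (rN i) (polyfunZ _ (Bk i))) (grad_polyfunZ _ z (Bk
    i)).
  rewrite (alphaE i)// addrfctE !scale_funE.
  have H (x y : R) (v1 v2 v3 : R * R) :
      x * dot (v1 + y *: v2) v3 = x * dot v1 v3 + x * y * dot v2 v3.
    by rewrite /dot /= /GRing.scale/=; ring.
  exact: H.
(* Cell by cell the two sums differ by a multiple of the integral of [bp i], which is zero by
   orthogonality. *)
rewrite e1 e2; apply: eq_bigr => i _.
have bp0 : \int[lebesgue2 R]_(z in hull (T i)) bp i z = 0 by exact: orth.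
move: bp0; rewrite hG => bp0.
have [? [? [? [? [? [? [FE GE FK GK]]]]]]] := HG i.
rewrite (Rintegral_affine_triangleD FE GE GK (polyfunZ _ (rpk i)) (polyfunZ _
  (bpk i))).
rewrite (Rintegral_affine_triangleZ FE GE GK (alpha0 * gamma i) (bpk i)).
by rewrite [X in _ + _ * X]bp0 mulr0 addr0.
Qed.
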